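(* Let $\Lambda(z)\in\mathbb{C}[z]$ be a monic polynomial of degree $m+n$ and assume that $\Lambda(0)\neq 0$. For every choice $(x_{1}(0),\ldots,x_{m}(0),y_{1}(0),\ldots,y_{n}(0))\in\mathbb{C}^{m+n}$ of a solution of the infinite $QQ$-system, i.e. such that the polynomials $Q_+(z)=\prod_{i=1}^m(z+x_i(0))$ and $Q_-(z)=q^{-m}\prod_{j=1}^n(z+y_j(0))$ satisfy $Q_+(qz)Q_-(z)=\Lambda(z)$, there exist $\epsilon>0$ and analytic functions $x_{1}(t),\ldots,x_{m}(t),y_{1}(t),\ldots,y_{n}(t)$ (with the given values at $t=0$) that solve the finite $QQ$-system with parameter $t$ for all $t\in\mathbb{C}$ such that $|t|<\epsilon$; that is, the polynomials $$Q_+^t(z)=\prod_{i=1}^m(z+x_i(t)),\qquad Q_-^t(z)=\frac{1}{q^m-tq^n}\prod_{j=1}^n(z+y_j(t))$$ satisfy $$Q_+^t(qz)Q_-^t(z)-t\,Q_+^t(z)Q_-^t(qz)=\Lambda(z).$$ Moreover, in this way we get all solutions of this finite $QQ$-system, and of the corresponding Bethe equations, for small enough $t$.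
   Context: $q\in\mathbb{C}^\times$ is fixed. The $SL_2$ $QQ$-system is $\zeta Q_+(qz)Q_-(z)-\zeta^{-1}Q_+(z)Q_-(qz)=\Lambda(z)$ with $Q_+$ monic; with $t=\zeta^{-2}$ and after replacing $\zeta Q_-$ by $Q_-$ it becomes the finite $QQ$-system with parameter $t$ appearing in the claim, whose limit $t\to0$ is the infinite $QQ$-system $Q_+(qz)Q_-(z)=\Lambda(z)$. Solutions are considered with $\deg Q_+=m$, $\deg Q_-=n$, $Q_+$ monic; comparing leading coefficients forces the leading coefficient of $Q_-$ to be $1/(q^m-tq^n)$. The corresponding Bethe equations (of the XXZ model associated to $U_q\hat{\mathfrak{sl}}_2$, with twist $\mathrm{diag}(\zeta,\zeta^{-1})$, $t=\zeta^{-2}\neq0$) are the equations in the unknowns $w_1,\ldots,w_m$, where $Q_+(z)=\prod_{j=1}^m(z-w_j)$: $$\zeta^{2}\,\frac{Q_+(qw_k)}{Q_+(q^{-1}w_k)}=-\frac{\Lambda(w_k)}{\Lambda(q^{-1}w_k)},\qquad k=1,\ldots,m.$$ Solutions of the Bethe equations correspond to those solutions $(Q_+,Q_-)$ of the $QQ$-system for which the zeros of $Q_+$ are $q$-distinct from the zeros of $\Lambda$ ($u,v\in\mathbb{C}^\times$ are $q$-distinct if $q^{\mathbb{Z}}u\cap q^{\mathbb{Z}}v=\varnothing$), via taking $w_k$ to be the roots of $Q_+$, i.e. $w_k=-x_k$.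
   Formalization: Λ is additionally assumed to have simple zeros (for m=n=1, Λ=(z-a)², q≠1 no analytic solution exists), and solutions of the Bethe equations are taken with pairwise distinct w_k and nonvanishing denominators. *)

(* Defs.v *)
From HB Require Import structures.
From mathcomp Require Import all_boot all_order all_algebra.
From mathcomp Require Import complex.
From mathcomp Require Import separable.
From mathcomp Require Import boolp classical_sets reals topology normedtype.
From mathcomp Require Import sequences.

Set Implicit Arguments.
Unset Strict Implicit.
Unset Printing Implicit Defensive.

Import Order.TTheory GRing.Theory Num.Theory.
Import numFieldNormedType.Exports.

Local Open Scope classical_set_scope.
Local Open Scope ring_scope.
Local Open Scope complex_scope.

(* The modulus makes R[i] a normed module over itself, hence a topological space. *)
HB.instance Definition _ (R : realType) := NormedModule.copy R[i] R[i]^o.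

(* f is the sum of a convergent power series around every point of D. *)
Definition analytic_on (R : realType) (D : set R[i]) (f : R[i] -> R[i]) : Prop :=
  forall t0, D t0 -> exists a : nat -> R[i],
    \forall t \near t0, series (fun k => a k * (t - t0) ^+ k) @ \oo --> f t.

Definition disc (R : realType) (eps : R) : set R[i] :=
  [set t | `|t| < eps%:C].

(* P(z) |-> P(q z) *)
Definition qshift (R : realType) (q : R[i]) (P : {poly R[i]}) : {poly R[i]} :=
  P \Po (q *: 'X).

Definition infinite_QQ (R : realType) (q : R[i]) (L P M : {poly R[i]}) : Prop :=
  qshift q P * M = L.

Definition finite_QQ (R : realType) (q t : R[i]) (L P M : {poly R[i]}) : Prop :=
  qshift q P * M - t *: (P * qshift q M) = L.

Definition Qplus (R : realType) (m : nat) (x : 'I_m -> R[i]) : {poly R[i]} :=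
  \prod_(i < m) ('X + (x i)%:P).

Definition Qminus (R : realType) (q t : R[i]) (m n : nat) (y : 'I_n -> R[i]) :
    {poly R[i]} :=
  (q ^+ m - t * q ^+ n)^-1 *: \prod_(j < n) ('X + (y j)%:P).

Definition infinite_solution (R : realType) (q : R[i]) (L : {poly R[i]})
    (m n : nat) (x0 : 'I_m -> R[i]) (y0 : 'I_n -> R[i]) : Prop :=
  infinite_QQ q L (Qplus x0) (q ^- m *: \prod_(j < n) ('X + (y0 j)%:P)).

(* Where the denominator q^m - t q^n vanishes, Qminus is 0, so the equation
   fails for L != 0. *)
Definition analytic_solution (R : realType) (q : R[i]) (L : {poly R[i]})
    (m n : nat) (x0 : 'I_m -> R[i]) (y0 : 'I_n -> R[i])
    (eps : R) (x : 'I_m -> R[i] -> R[i]) (y : 'I_n -> R[i] -> R[i]) : Prop :=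
  [/\ 0 < eps,
      forall i, analytic_on (disc eps) (x i) /\ x i 0 = x0 i,
      forall j, analytic_on (disc eps) (y j) /\ y j 0 = y0 j &
      forall t, disc eps t ->
        finite_QQ q t L (Qplus (x^~ t)) (Qminus q t m (y^~ t))].

Definition finite_solution (R : realType) (q t : R[i]) (L : {poly R[i]})
    (m n : nat) (P M : {poly R[i]}) : Prop :=
  [/\ P \is monic, size P = m.+1, size M = n.+1 & finite_QQ q t L P M].

Definition q_distinct (R : realType) (q u v : R[i]) : Prop :=
  [/\ u != 0, v != 0 & forall a b : int, q ^ a * u != q ^ b * v].

(* Division being total, the denominators are required not to vanish. The
   unknowns are pairwise distinct: at a multiple root of Q_+ the repeated
   equation has solutions that do not come from the QQ-system. *)
Definition Bethe_solution (R : realType) (q zeta : R[i]) (L : {poly R[i]})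
    (m : nat) (w : 'I_m -> R[i]) : Prop :=
  let Q := \prod_(j < m) ('X - (w j)%:P) in
  injective w /\
  forall k : 'I_m,
    [/\ Q.[q^-1 * w k] != 0, L.[q^-1 * w k] != 0 &
      zeta ^+ 2 * (Q.[q * w k] / Q.[q^-1 * w k])
        = - (L.[w k] / L.[q^-1 * w k])].

(* Main.v *)
Require Import Defs.
From mathcomp Require Import all_boot all_order all_algebra.
From mathcomp Require Import complex separable.
From mathcomp Require Import boolp classical_sets reals topology normedtype.
From mathcomp Require Import sequences perm.
From mathcomp Require Import ring lra zify.

Set Implicit Arguments.
Unset Strict Implicit.
Unset Printing Implicit Defensive.

Import Order.TTheory GRing.Theory Num.Theory.
Import numFieldNormedType.Exports.
Import Normc.

Local Open Scope classical_set_scope.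
Local Open Scope ring_scope.
Local Open Scope complex_scope.

(** Let s collect the m + n numbers -x_i/q and -y_j, the zeros of
[Q_+(q z)] and of [Q_-(z)]. In terms of s the finite QQ-system says

  q^m prod_k (X - s_k) - t prod_k (b_k X - c_k s_k)
                              = (q^m - t q^n) prod_k (X - lam_k),

where the lam_k are the zeros of L, and (b_k, c_k) is (1, q) on the first m
indices and (q, 1) on the last n: it deforms a factorization of L into linear
factors. At t = 0 its solutions s are the arrangements of the zeros of L, which
are therefore the solutions of the infinite system.

Both sides have degree m + n and the same leading coefficient, so for distinct
s_k the identity may be tested at the points s_k. There it becomes
[defect t s k = 0], and at t = 0, s = lam the Jacobian of the defect is diagonal
with entries q^m L'(lam_k), which do not vanish because L has simple zeros. This
is the situation of the analytic implicit function theorem, proved here by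
Newton iteration with that fixed diagonal. The iterates are polynomials in t. For
the weighted norm sum_k |p_k| r^k the iteration is a contraction
([newton_contraction]); a geometrically convergent sequence of polynomials has
an analytic limit ([analytic_limit]), which gives the branch, while the same
contraction applied to constant polynomials gives local uniqueness
([deformation_local]).

That these branches are all the solutions for small t is a compactness argument
made explicit ([deformation_localised]). If |s_k| is maximal and large, the
defect equation at k is violated, since its two terms grow at the same rate
and one of them carries the factor t; so all s_k stay bounded. Evaluating the
identity at a zero of L then shows that some s_k is close to it. Hence s is close
to one of the finitely many arrangements of the zeros of L, and local uniqueness
puts it on the corresponding branch ([branches_exhaust]).

For the Bethe equations, a polynomial [Q_+] whose zeros satisfy them is completed
to a solution of the QQ-system ([QQ_partner_of_Bethe]): interpolation makes the
QQ-equation hold at all zeros of [Q_+(z) Q_+(q z)], and the remaining multiple of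
that product is absorbed by solving the q-difference equation
g(z) - t g(q z) = h(z), coefficient by coefficient. The converse is evaluation of
the QQ-equation at w_k and at w_k / q. *)

(** * Moduli and limits of complex numbers *)

(* Otherwise the modulus of 0 unfolds into a square root. *)
Local Arguments normc : simpl never.

Section Modulus.
Variable R : realType.
Implicit Types (x y z t : R[i]) (e : R).

Lemma norm_normc z : `|z| = (normc z)%:C.
Proof. by rewrite normc_def; case: z. Qed.

Lemma normc_ge0 z : 0 <= normc z.
Proof. by case: z => a b; apply: sqrtr_ge0. Qed.

Lemma normcD x y : normc (x + y) <= normc x + normc y.
Proof. exact: le_normcD. Qed.

Lemma normc_opp x : normc (- x) = normc x.
Proof. exact: complex.normcN. Qed.

Lemma normcB x y : normc (x - y) <= normc x + normc y.
Proof. by rewrite -(normc_opp y) normcD. Qed.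

Lemma normcBC x y : normc (x - y) = normc (y - x).
Proof. by rewrite -normc_opp opprB. Qed.

Lemma normc_triangle z x y : normc (x - y) <= normc (x - z) + normc (z - y).
Proof. by rewrite -[x - y](subrKA z) normcD. Qed.

Lemma normc_eq0 z : (normc z == 0) = (z == 0).
Proof.
by apply/eqP/eqP => [/eq0_normc//|->]; apply: normc0.
Qed.

Lemma normc_gt0 z : (0 < normc z) = (z != 0).
Proof. by rewrite lt_neqAle normc_ge0 andbT eq_sym normc_eq0. Qed.

Lemma normcX z n : normc (z ^+ n) = normc z ^+ n.
Proof. by elim: n => [|n IH]; rewrite ?expr0 ?normc1 // !exprS normcM IH. Qed.

Lemma normc_prod (I : finType) (F : I -> R[i]) :
  normc (\prod_i F i) = \prod_i normc (F i).
Proof. exact: (big_morph _ (@normcM R) (@normc1 R)). Qed.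

Lemma normc_sum n (F : nat -> R[i]) :
  normc (\sum_(i < n) F i) <= \sum_(i < n) normc (F i).
Proof.
elim: n => [|n IH]; first by rewrite !big_ord0 normc0.
by rewrite !big_ord_recr /= (le_trans (normcD _ _))// lerD2r.
Qed.

Lemma normc_real e : 0 <= e -> normc (e%:C) = e.
Proof. by move=> e0; rewrite /normc /= expr0n addr0 sqrtr_sqr ger0_norm. Qed.

Lemma discE e t : disc e t <-> normc t < e.
Proof. by rewrite /disc /= norm_normc ltcR. Qed.

Lemma nearCP t0 (P : R[i] -> Prop) :
  (\forall t \near t0, P t) <->
  exists2 e : R, 0 < e & forall t, normc (t - t0) < e -> P t.
Proof.
split.
- move/nbhs_normP => [e /= e0 H].
  have re : e \is Num.real by rewrite gtr0_real.
  exists (complex.Re e); first by rewrite -ltcR RRe_real.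
  move=> t te; apply: H; rewrite /ball_ /= distrC norm_normc.
  by rewrite -(RRe_real re) ltcR.
- move=> [e e0 H]; apply/nbhs_normP; exists (e%:C) => /=; first by rewrite ltcR.
  by move=> t; rewrite /ball_ /= distrC norm_normc ltcR; apply: H.
Qed.

Lemma cvgCP (u : nat -> R[i]) (l : R[i]) :
  u @ \oo --> l <->
  forall e : R, 0 < e -> exists N, forall n, (N <= n)%N -> normc (u n - l) < e.
Proof.
split.
- move=> /cvgrPdist_lt ul e e0.
  have /ul [N _ H] : 0 < e%:C by rewrite ltcR.
  by exists N => n Nn; move: (H n Nn); rewrite /= distrC norm_normc ltcR.
- move=> H; apply/cvgrPdist_lt => e e0.
  have re : e \is Num.real by rewrite gtr0_real.
  have [|N HN] := H (complex.Re e); first by rewrite -ltcR RRe_real.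
  exists N => // n Nn /=; rewrite distrC norm_normc -(RRe_real re) ltcR.
  exact: HN.
Qed.

Lemma half_powers_small (C e : R) : 0 <= C -> 0 < e ->
  exists p : nat, C / 2 ^+ p < e.
Proof.
move=> C0 e0; have HN := archi_boundP (divr_ge0 C0 (ltW e0)).
exists (Num.bound (C / e)); set N := Num.bound _ in HN *.
rewrite ltr_pdivrMr ?exprn_gt0 // mulrC -ltr_pdivrMr //.
by rewrite (lt_trans HN) // -natrX ltr_nat ltn_expl.
Qed.

Lemma geometric_telescope (V : zmodType) (N : V -> R) (u : nat -> V) (C : R) :
  N 0 = 0 -> (forall x y : V, N (x + y) <= N x + N y) -> 0 <= C ->
  (forall p, N (u p.+1 - u p) <= C / 2 ^+ p) ->
  forall p k, N (u (p + k)%N - u p) <= 2 * C / 2 ^+ p.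
Proof.
move=> N0 ND C0 uC p k.
have H : N (u (p + k)%N - u p) <= 2 * C * (1 / 2 ^+ p - 1 / 2 ^+ (p + k)).
  elim: k => [|k IH]; first by rewrite addn0 !subrr N0 mulr0.
  rewrite addnS -(subrKA (u (p + k)%N)); apply: le_trans (ND _ _) _.
  have := lerD (uC (p + k)%N) IH; move/le_trans; apply.
  by rewrite exprS invfM; lra.
apply: le_trans H _; rewrite ler_wpM2l ?mulr_ge0 // div1r.
by rewrite lerBlDr lerDl divr_ge0 // exprn_ge0.
Qed.

Lemma real_geometric_limit (u : nat -> R) (C : R) :
  (forall p, `|u p.+1 - u p| <= C / 2 ^+ p) ->
  exists l, forall p, `|l - u p| <= 2 * C / 2 ^+ p.
Proof.
move=> uC; have C0 : 0 <= C.
  by have := uC 0%N; rewrite expr0 divr1; apply: le_trans.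
have H' := geometric_telescope (@normr0 R R) (@ler_normD R R) C0 uC.
pose A := [set x | exists p, x = u p - 2 * C / 2 ^+ p].
have Aub p : ubound A (u p + 2 * C / 2 ^+ p).
  move=> _ [k ->].
  have h0 j : 0 <= 2 * C / 2 ^+ j :> R by rewrite !mulr_ge0 ?invr_ge0 ?exprn_ge0.
  have [pk|kp] := leqP p k.
    have := H' p (k - p)%N; rewrite subnKC // ler_norml => /andP[_].
    by have := h0 k; lra.
  have := H' k (p - k)%N; rewrite subnKC 1?ltnW // ler_norml => /andP[+ _].
  by have := h0 p; lra.
have As : has_sup A.
  by split; [exists (u 0%N - 2 * C / 2 ^+ 0); exists 0%N
            | exists (u 0%N + 2 * C / 2 ^+ 0)].
exists (sup A) => p; rewrite ler_distl; apply/andP; split.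
  by apply: ub_le_sup; [exact: As.2 | exists p].
by apply: ge_sup => //; exact: As.1.
Qed.

Lemma normc_le_ReIm z : normc z <= `|complex.Re z| + `|complex.Im z|.
Proof.
case: z => a b; rewrite /normc /=.
rewrite -[leRHS]ger0_norm ?addr_ge0 // -sqrtr_sqr ler_wsqrtr //.
rewrite sqrrD !real_normK ?num_real // lerD2r lerDl.
by rewrite mulrn_wge0 // mulr_ge0.
Qed.

Lemma normc_ge_ReIm z : `|complex.Re z| <= normc z /\ `|complex.Im z| <= normc z.
Proof.
by case: z => a b; rewrite /normc /= -!sqrtr_sqr !ler_wsqrtr ?lerDl ?lerDr ?sqr_ge0.
Qed.

(** Completeness of the complex numbers, with the rate of convergence that the
estimates below need. It is deduced from the real case coordinatewise. *)
Lemma geometric_limit (u : nat -> R[i]) (C : R) :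
  (forall p, normc (u p.+1 - u p) <= C / 2 ^+ p) ->
  exists l, forall p, normc (l - u p) <= 4 * C / 2 ^+ p.
Proof.
move=> uC.
have [|a Ha] := @real_geometric_limit (fun p => complex.Re (u p)) C.
  move=> p; apply: le_trans (uC p); rewrite -raddfB.
  exact: (normc_ge_ReIm _).1.
have [|b Hb] := @real_geometric_limit (fun p => complex.Im (u p)) C.
  move=> p; apply: le_trans (uC p); rewrite -raddfB.
  exact: (normc_ge_ReIm _).2.
exists (a +i* b) => p; apply: le_trans (normc_le_ReIm _) _.
rewrite !raddfB /=; have := lerD (Ha p) (Hb p); lra.
Qed.

Lemma le_of_half_powers (x C : R) : (forall p : nat, x <= C / 2 ^+ p) -> x <= 0.
Proof.
move=> H; rewrite leNgt; apply/negP => x0.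
have C0 : 0 <= C by have := H 0%N; rewrite expr0 divr1; lra.
by have [p] := half_powers_small C0 x0; rewrite ltNge H.
Qed.

End Modulus.

(** * A weighted norm on polynomials *)

Section WeightedNorm.
Variable R : realType.
Implicit Types (p q : {poly R[i]}) (r : R) (a c t : R[i]).

(** This norm is submultiplicative, agrees with the modulus on constants, gives
'X the value r, and dominates the values on the disc of radius r: estimates in
the algebra of polynomials are at once estimates for all those values. *)
Definition wnorm r p : R := \sum_(i < size p) normc p`_i * r ^+ i.

Lemma wnorm_wide n r p : (size p <= n)%N ->
  wnorm r p = \sum_(i < n) normc p`_i * r ^+ i.
Proof.
move=> pn; rewrite /wnorm (big_ord_widen n (fun i => normc p`_i * r ^+ i)) //.
rewrite big_mkcond; apply: eq_bigr => i _; case: ltnP => // pi.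
by rewrite nth_default // normc0 mul0r.
Qed.

Lemma wnorm_ge_sum n r p : 0 <= r ->
  \sum_(i < n) normc p`_i * r ^+ i <= wnorm r p.
Proof.
move=> r0; rewrite (@wnorm_wide (maxn n (size p))) ?leq_maxr //.
rewrite (big_ord_widen (maxn n (size p)) (fun i => normc p`_i * r ^+ i)) ?leq_maxl //.
rewrite big_mkcond; apply: ler_sum => i _; case: ltnP => // _.
by rewrite mulr_ge0 ?normc_ge0 ?exprn_ge0.
Qed.

Lemma wnorm_ge0 r p : 0 <= r -> 0 <= wnorm r p.
Proof. by move=> r0; rewrite (le_trans _ (wnorm_ge_sum 0 p r0)) // big_ord0. Qed.

Lemma wnorm_coef r p j : 0 <= r -> normc p`_j * r ^+ j <= wnorm r p.
Proof.
move=> r0; apply: le_trans (wnorm_ge_sum j.+1 p r0); rewrite big_ord_recr /=.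
by rewrite lerDr sumr_ge0 // => i _; rewrite mulr_ge0 ?normc_ge0 ?exprn_ge0.
Qed.

Lemma wnormD r p q : 0 <= r -> wnorm r (p + q) <= wnorm r p + wnorm r q.
Proof.
move=> r0; set n := maxn (size p) (size q).
rewrite !(@wnorm_wide n) ?leq_maxr ?leq_maxl ?size_polyD // -big_split /=.
apply: ler_sum => i _; rewrite coefD -mulrDl ler_wpM2r ?exprn_ge0 //.
exact: normcD.
Qed.

Lemma wnormN r p : wnorm r (- p) = wnorm r p.
Proof.
by rewrite /wnorm size_polyN; apply: eq_bigr => i _; rewrite coefN normc_opp.
Qed.

Lemma wnormB r p q : 0 <= r -> wnorm r (p - q) <= wnorm r p + wnorm r q.
Proof. by move=> r0; rewrite -(wnormN r q) wnormD. Qed.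

Lemma wnormC r c : wnorm r c%:P = normc c.
Proof.
rewrite (@wnorm_wide 1) ?size_polyC ?leq_b1 // big_ord_recl big_ord0.
by rewrite coefC expr0 mulr1 addr0.
Qed.

Lemma wnormXM r p : wnorm r ('X * p) = r * wnorm r p.
Proof.
rewrite (@wnorm_wide (size p).+1); last first.
  by rewrite (leq_trans (size_polyMleq _ _)) // size_polyX.
rewrite big_ord_recl coefXM /= normc0 mul0r add0r mulr_sumr.
by apply: eq_bigr => i _; rewrite coefXM /= exprS mulrCA.
Qed.

Lemma wnormX r : wnorm r 'X = r.
Proof. by rewrite -['X]mulr1 wnormXM wnormC normc1 mulr1. Qed.

Lemma wnormCM r c p : wnorm r (c%:P * p) = normc c * wnorm r p.
Proof.
rewrite mul_polyC (@wnorm_wide (size p)) ?size_scale_leq // mulr_sumr.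
by apply: eq_bigr => i _; rewrite coefZ normcM mulrA.
Qed.

Lemma wnorm_MXaddC r p c : wnorm r (p * 'X + c%:P) = r * wnorm r p + normc c.
Proof.
rewrite (@wnorm_wide (size p).+1); last first.
  by rewrite -cons_poly_def size_cons_poly; case: ifP.
rewrite big_ord_recl coefD coefMX coefC add0r expr0 mulr1 addrC mulr_sumr.
congr (_ + _); apply: eq_bigr => i _.
by rewrite coefD coefMX coefC addr0 exprS mulrCA.
Qed.

Lemma wnormM r p q : 0 <= r -> wnorm r (p * q) <= wnorm r p * wnorm r q.
Proof.
move=> r0; elim/poly_ind: p => [|p c IH].
  by rewrite mul0r -polyC0 wnormC normc0 mul0r.
rewrite wnorm_MXaddC !mulrDl (le_trans (wnormD _ _ r0)) //.
rewrite wnormCM lerD2r -mulrA ['X * q]mulrC mulrA mulrC wnormXM -mulrA.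
by rewrite ler_wpM2l.
Qed.

Lemma wnorm_horner r p t : normc t <= r -> normc p.[t] <= wnorm r p.
Proof.
move=> tr; have r0 := le_trans (normc_ge0 t) tr.
rewrite horner_coef (le_trans (normc_sum _ (fun i => p`_i * t ^+ i))) //.
apply: ler_sum => i _; rewrite normcM normcX ler_wpM2l ?normc_ge0 //.
by rewrite lerXn2r // nnegrE normc_ge0.
Qed.

(** Expanding at a costs |a| in the radius, because 'X + a has norm at most
r + |a| and the norm is submultiplicative. *)
Lemma wnorm_translate r a p : 0 <= r ->
  wnorm r (p \Po ('X + a%:P)) <= wnorm (r + normc a) p.
Proof.
move=> r0; elim/poly_ind: p => [|p c IH].
  by rewrite comp_poly0 -!polyC0 !wnormC normc0.
rewrite comp_polyD comp_polyM comp_polyX comp_polyC wnorm_MXaddC.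
rewrite (le_trans (wnormD _ _ r0)) // wnormC lerD2r mulrC.
rewrite (le_trans (wnormM _ _ r0)) // ler_pM ?wnorm_ge0 //.
by rewrite (le_trans (wnormD _ _ r0)) // wnormX wnormC.
Qed.

End WeightedNorm.

(** * Analytic functions as limits of polynomials *)

Section AnalyticLimits.
Variable R : realType.

(** Around t0 in the disc, the Taylor coefficients of the S p at t0 converge
geometrically for the radius r - |t0| by [wnorm_translate]; their limits b_j are
the coefficients of f. A partial sum of length J of the series of f is compared
with S p, for p fixed and J beyond the degree of S p. *)
Lemma analytic_limit (S : nat -> {poly R[i]}) (r C : R) :
  (forall p, wnorm r (S p.+1 - S p) <= C / 2 ^+ p) ->
  exists f : R[i] -> R[i], analytic_on (disc r) f /\
    forall t, normc t < r -> forall p, normc (f t - (S p).[t]) <= 4 * C / 2 ^+ p.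
Proof.
move=> SC.
have [r0|r0] := leP r 0.
  exists (fun=> 0); split => [t /discE|t] tr; have := normc_ge0 t; lra.
have C0 : 0 <= C.
  have := SC 0%N; rewrite expr0 divr1; apply: le_trans.
  by rewrite wnorm_ge0 // ltW.
have /choice[f Hf] : forall t, exists l, normc t < r ->
    forall p, normc (l - (S p).[t]) <= 4 * C / 2 ^+ p.
  move=> t; have [tr|tr] := ltP (normc t) r; last by exists 0.
  have [|l Hl] := @geometric_limit R (fun p => (S p).[t]) C.
    move=> p; rewrite -hornerN -hornerD; apply: le_trans (SC p).
    by rewrite wnorm_horner // ltW.
  by exists l.
exists f; split => // t0 /discE t0r.
pose r' := r - normc t0; have r'0 : 0 < r' by rewrite subr_gt0.
have r'0w := ltW r'0.
pose c p := S p \Po ('X + t0%:P).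
have cC p : wnorm r' (c p.+1 - c p) <= C / 2 ^+ p.
  rewrite -comp_polyB; apply: le_trans (wnorm_translate _ _ r'0w) _.
  by rewrite /r' subrK.
have /choice[b Hb] : forall j, exists l, forall p,
    normc (l - (c p)`_j) <= 4 * (C / r' ^+ j) / 2 ^+ p.
  move=> j; apply: geometric_limit => p; rewrite -coefB.
  rewrite mulrAC ler_pdivlMr ?exprn_gt0 //.
  exact: le_trans (wnorm_coef _ _ r'0w) (cC p).
exists b; apply/nearCP; exists r' => // t tr'.
have tr : normc t < r.
  have := normcD (t - t0) t0; rewrite subrK /r' in tr' *; lra.
apply/cvgCP => e e0.
have [p Hp] := half_powers_small (mulr_ge0 (ler0n R 6) C0) e0.
exists (size (c p)) => J pJ; apply: le_lt_trans Hp.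
rewrite -subr_le0; apply: (@le_of_half_powers _ _ (4 * C * J%:R)) => k.
(* s1 tends to 0 as k grows with J fixed; s2 and s3 are O(2^-p) uniformly in J
   and k. *)
pose s1 := \sum_(j < J) (b j - (c (p + k)%N)`_j) * (t - t0) ^+ j.
pose s2 := \sum_(j < J) (c (p + k)%N - c p)`_j * (t - t0) ^+ j.
pose s3 := (c p).[t - t0] - f t.
have -> : series (fun j => b j * (t - t0) ^+ j) J - f t = s1 + s2 + s3.
  rewrite /s1 /s2 /s3 (horner_coef_wide _ pJ) addrA -!big_split /= seriesEord.
  by congr (_ - _); apply: eq_bigr => j _; rewrite coefB; ring.
have tw : normc (t - t0) <= r' by exact: ltW.
have s1_le : normc s1 <= 4 * C * J%:R / 2 ^+ k.
  apply: le_trans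
    (normc_sum _ (fun j => (b j - (c (p + k)%N)`_j) * (t - t0) ^+ j)) _.
  have -> : 4 * C * J%:R / 2 ^+ k = \sum_(j < J) 4 * C / 2 ^+ k.
    by rewrite sumr_const card_ord -[RHS]mulr_natr mulrAC.
  apply: ler_sum => j _; rewrite normcM normcX.
  have tj : normc (t - t0) ^+ j <= r' ^+ j.
    by rewrite lerXn2r // nnegrE normc_ge0.
  have := ler_pM (normc_ge0 _) (exprn_ge0 j (normc_ge0 _)) (Hb j (p + k)%N) tj.
  move/le_trans; apply.
  have rj : r' ^+ j != 0 by rewrite gt_eqF ?exprn_gt0.
  have cancel_r (a x z : R) : x != 0 -> 4 * (a / x) / z * x = 4 * a / z.
    by move=> x0; rewrite mulrAC -(mulrA 4 (a / x)) divfK.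
  rewrite cancel_r // ler_wpM2l ?mulr_ge0 // lef_pV2 ?posrE ?exprn_gt0 //.
  by rewrite ler_eXn2l ?ltr1n // leq_addl.
have s2_le : normc s2 <= 2 * C / 2 ^+ p.
  apply: le_trans
    (normc_sum _ (fun j => (c (p + k)%N - c p)`_j * (t - t0) ^+ j)) _.
  apply: le_trans (geometric_telescope _ _ C0 cC p k); last 2 first.
  - by rewrite -polyC0 wnormC normc0.
  - by move=> x y; apply: wnormD.
  apply: le_trans (wnorm_ge_sum J _ r'0w).
  apply: ler_sum => j _; rewrite normcM normcX ler_wpM2l ?normc_ge0 //.
  by rewrite lerXn2r // nnegrE normc_ge0.
have s3_le : normc s3 <= 4 * C / 2 ^+ p.
  by rewrite /s3 /c horner_comp !hornerE subrK normcBC Hf.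
have := normcD (s1 + s2) s3; have := normcD s1 s2; lra.
Qed.

Lemma cvg_normc_le (u : nat -> R[i]) (l a : R[i]) (B : R) :
  u @ \oo --> l -> (forall n, normc (u n.+1 - a) <= B) -> normc (l - a) <= B.
Proof.
move=> /cvgCP ul uB; rewrite leNgt; apply/negP; rewrite -subr_gt0.
move=> /ul [N /(_ N.+1 (leqnSn N))]; have := uB N.
have := normc_triangle (u N.+1) l a; rewrite (normcBC l (u N.+1)); lra.
Qed.

(** The terms of a power series converging at distance r are bounded by B, so
at distance x r, for x <= 1/2, the series differs from its constant term by at
most 2 B x. *)
Lemma analytic_continuous (D : set R[i]) (f : R[i] -> R[i]) (t0 : R[i]) :
  analytic_on D f -> D t0 -> forall e : R, 0 < e ->
  exists2 delta : R, 0 < delta &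
    forall t, normc (t - t0) < delta -> normc (f t - f t0) < e.
Proof.
move=> fD /fD [a /nearCP [d d0 H]] e e0.
have [r r0 rd] : exists2 r : R, 0 < r & r < d by exists (d / 2); lra.
have nr : normc (t0 + r%:C - t0) = r by rewrite addrC addKr normc_real // ltW.
have /H cr : normc (t0 + r%:C - t0) < d by rewrite nr.
have f0 : f t0 = a 0%N.
  have /H c0 : normc (t0 - t0) < d by rewrite subrr normc0.
  apply/eqP; rewrite -subr_eq0 -normc_eq0 eq_le normc_ge0 andbT.
  apply: cvg_normc_le c0 _ => n; rewrite seriesEord /= big_ord_recl expr0 mulr1.
  rewrite addrC addKr big1 ?normc0 // => i _.
  by rewrite subrr expr0n /= mulr0.
have [B B0 HB] : exists2 B : R, 0 <= B & forall k, normc (a k) * r ^+ k <= B.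
  have /cvgP/cvg_series_cvg_0/cvgP/cvg_seq_bounded/pinfty_ex_gt0 [M /= M0 HM] := cr.
  have rM : M \is Num.real by rewrite gtr0_real.
  exists (complex.Re M) => [|k].
    by rewrite -lecR RRe_real // ltW.
  have := HM k I; rewrite /= norm_normc -(RRe_real rM) lecR normcM normcX.
  by rewrite addrAC subrr add0r normc_real // ltW.
exists (Num.min (r / 2) (r * e / (2 * B + 1) / 2)) => [|t].
  have B1 : 0 < 2 * B + 1 by lra.
  have e1 : 0 < r * e / (2 * B + 1) by rewrite divr_gt0 ?mulr_gt0.
  by rewrite lt_min; apply/andP; split; lra.
rewrite lt_min => /andP[tr te].
have /H ct : normc (t - t0) < d by lra.
set x := normc (t - t0) / r.
have x0 : 0 <= x by rewrite divr_ge0 ?normc_ge0 // ltW.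
have x2 : x <= 1 / 2.
  by rewrite ler_pdivrMr // ltW // mulrC mulrA mulr1.
suff H2 : normc (f t - a 0%N) <= 2 * B * x.
  rewrite f0; apply: le_lt_trans H2 _.
  have B1 : 0 < 2 * B + 1 by lra.
  have : (2 * B + 1) * x <= e / 2.
    rewrite mulrC -ler_pdivlMr // ler_pdivrMr // ltW //; apply: lt_le_trans te _.
    by rewrite le_eqVlt; apply/orP; left; apply/eqP; field; rewrite gt_eqF.
  lra.
apply: cvg_normc_le ct _ => n; rewrite seriesEord /= big_ord_recl expr0 mulr1.
rewrite addrC addKr.
apply: le_trans (normc_sum _ (fun i => a i.+1 * (t - t0) ^+ i.+1)) _.
have le1 i : normc (a i.+1 * (t - t0) ^+ i.+1) <= B * x ^+ i.+1.
  rewrite normcM normcX -(divfK (lt0r_neq0 r0) (normc (t - t0))) -/x exprMn.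
  by rewrite mulrCA mulrC ler_wpM2r ?exprn_ge0 // mulrC.
have le2 : \sum_(i < n) x ^+ i.+1 <= 2 * x * (1 - x ^+ n).
  elim: n => [|n IH]; first by rewrite big_ord0 expr0 subrr mulr0.
  rewrite big_ord_recr /=; apply: le_trans (lerD IH (lexx _)) _.
  rewrite !exprS; set y := x ^+ n; have y0 : 0 <= y by rewrite exprn_ge0.
  have h : 0 <= 1 - 2 * x by lra.
  have : 0 <= x * y * (1 - 2 * x) by apply: mulr_ge0 h; exact: mulr_ge0.
  lra.
apply: le_trans (ler_sum _ (fun (i : 'I_n) _ => le1 i)) _.
rewrite -mulr_sumr (mulrC 2) -mulrA ler_wpM2l //; apply: le_trans le2 _.
have := mulr_ge0 x0 (exprn_ge0 n x0); lra.
Qed.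
Lemma analytic_on_scale (D D' : set R[i]) (z : R[i]) (f : R[i] -> R[i]) :
  D' `<=` D -> analytic_on D f -> analytic_on D' (fun t => z * f t).
Proof.
move=> DD fD t0 /DD /fD [a Ha]; exists (fun k => z * a k).
apply: filterS Ha => t /cvgCP H; apply/cvgCP => e e0.
have nz : 0 < normc z + 1 by rewrite ltr_wpDl ?normc_ge0.
have [N HN] := H (e / (normc z + 1)) (divr_gt0 e0 nz).
exists N => n Nn; have := HN n Nn; rewrite ltr_pdivlMr //.
set u := series _ n - f t => Hu.
have -> : series (fun k => z * a k * (t - t0) ^+ k) n - z * f t = z * u.
  rewrite /u mulrBr !seriesEord /= mulr_sumr; congr (_ - _).
  by apply: eq_bigr => k _; rewrite mulrA.
rewrite normcM; have := normc_ge0 u; lra.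
Qed.

End AnalyticLimits.

(** * Finite families *)

Section FiniteChoice.
Variable R : realType.

(** The minimum of finitely many admissible radii is admissible. *)
Lemma uniform_pos (J : finType) (P : J -> R -> Prop) :
  (forall j, exists2 d : R, 0 < d & P j d) ->
  (forall j d e, 0 < e -> e <= d -> P j d -> P j e) ->
  exists2 d : R, 0 < d & forall j, P j d.
Proof.
move=> Pex Pdown.
suff H (js : seq J) : exists2 d : R, 0 < d & forall j, j \in js -> P j d.
  have [d d0 Hd] := H (enum J); exists d => // j.
  by apply: Hd; rewrite mem_enum.
elim: js => [|j js [d d0 Hd]]; first by exists 1.
have [e e0 He] := Pex j.
have m0 : 0 < Num.min d e by rewrite lt_min d0.
exists (Num.min d e) => // i; rewrite in_cons => /orP[/eqP->|/Hd].
  by apply: Pdown He; rewrite // ge_min lexx orbT.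
by apply: Pdown; rewrite // ge_min lexx.
Qed.

Lemma separation (J : finType) (lam : J -> R[i]) : injective lam ->
  exists2 g : R, 0 < g & forall k l, k != l -> g <= normc (lam k - lam l).
Proof.
move=> lam_inj.
have [||g g0 H] := @uniform_pos (J * J)%type
    (fun kl g => kl.1 != kl.2 -> g <= normc (lam kl.1 - lam kl.2)).
- move=> [k l] /=; have [<-|kl] := eqVneq k l; first by exists 1.
  exists (normc (lam k - lam l)) => //; rewrite normc_gt0 subr_eq0.
  by apply: contra kl => /eqP/lam_inj->.
- by move=> kl d e _ ed H /H; apply: le_trans.
by exists g => // k l kl; apply: (H (k, l)).
Qed.

End FiniteChoice.

Section Products.
Variable F : fieldType.

Lemma size_coef_prod (J : finType) (G : J -> {poly F}) :
  (forall j, (size (G j) <= 2)%N) ->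
  (size (\prod_j G j)%R <= #|J|.+1)%N /\
  (\prod_j G j)`_#|J| = \prod_j (G j)`_1.
Proof.
move=> G2; rewrite cardE.
have -> : \prod_j G j = \prod_(j <- enum J) G j by rewrite big_enum.
have -> : \prod_j (G j)`_1 = \prod_(j <- enum J) (G j)`_1 by rewrite big_enum.
elim: (enum J) => [|j js [IH1 IH2]] /=.
  by rewrite !big_nil size_poly1 coef1.
rewrite !big_cons; set P := \prod_(i <- js | _) _ in IH1 IH2 *; split.
  apply: leq_trans (size_polyMleq _ _) _.
  by have := leq_add (G2 j) IH1; case: (size (G j) + size P)%N.
rewrite coefM (bigD1 (inord 1)) //= inordK // subSS subn0 IH2.
rewrite [X in _ + X]big1 ?addr0 // => -[[|[|i]] /= ilt] ine.
- by rewrite subn0 (nth_default _ IH1) mulr0.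
- by case/eqP: ine; apply/val_inj; rewrite /= inordK.
- by rewrite nth_default ?mul0r // (leq_trans (G2 j)).
Qed.

Lemma size_coef_prod_linear (J : finType) (x y : J -> F) :
  (size (\prod_j (x j *: 'X - (y j)%:P))%R <= #|J|.+1)%N /\
  (\prod_j (x j *: 'X - (y j)%:P))`_#|J| = \prod_j x j.
Proof.
have lin j : (size (x j *: 'X - (y j)%:P)%R <= 2)%N.
  rewrite (leq_trans (size_polyD _ _)) // geq_max size_polyN size_polyC.
  by rewrite (leq_trans (size_scale_leq _ _)) ?size_polyX //; case: eqP.
have [sz ->] := size_coef_prod lin; split=> //; apply: eq_bigr => j _.
by rewrite coefB coefZ coefX coefC mulr1 subr0.
Qed.

Lemma size_coef_prod_XsubC (J : finType) (y : J -> F) :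
  (size (\prod_j ('X - (y j)%:P))%R <= #|J|.+1)%N /\
  (\prod_j ('X - (y j)%:P))`_#|J| = 1.
Proof.
have := size_coef_prod_linear (fun=> 1) y; rewrite big1_eq.
by under eq_bigr do rewrite scale1r.
Qed.

End Products.

(** * Deformed factorizations *)

Section DeformedFactorization.
Variables (R : realType) (I : finType).
Variables (al be : R[i]) (b c lam : I -> R[i]).

Definition deformed (t : R[i]) (s : I -> R[i]) : Prop :=
  al *: \prod_k ('X - (s k)%:P) - t *: \prod_k (b k *: 'X - (c k * s k)%:P)
  = (al - t * be) *: \prod_k ('X - (lam k)%:P).

(** The value of the identity [deformed t s] at s_k, up to sign, where the first
product vanishes. The map j embeds the complex numbers into A: the defect is
used for numbers and for polynomials in t. *)
Definition defect (A : comNzRingType) (j : R[i] -> A) (T : A) (s : I -> A)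
    (k : I) : A :=
  (j al - T * j be) * \prod_l (s k - j (lam l))
  + T * \prod_l (j (b l) * s k - j (c l) * s l).

Lemma horner_defect (T : {poly R[i]}) (s : I -> {poly R[i]}) k t :
  (defect polyC T s k).[t] = defect id T.[t] (fun l => (s l).[t]) k.
Proof.
rewrite /defect !(hornerE, horner_prod); congr (_ * _ + _ * _);
  by apply: eq_bigr => l _; rewrite !hornerE.
Qed.

Lemma polyC_defect (t : R[i]) (s : I -> R[i]) k :
  defect polyC t%:P (fun l => (s l)%:P) k = (defect id t s k)%:P.
Proof.
rewrite /defect !(rmorphD, rmorphB, rmorphM, rmorph_prod) /=.
congr (_ * _ + _ * _); first by rewrite rmorphN rmorphM.
- by apply: eq_bigr => l _; rewrite rmorphB.
- by apply: eq_bigr => l _; rewrite rmorphB !rmorphM.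
Qed.

Lemma horner_prod_XsubC (s : I -> R[i]) z :
  (\prod_k ('X - (s k)%:P)).[z] = \prod_k (z - s k).
Proof. by rewrite horner_prod; apply: eq_bigr => k _; rewrite !hornerE. Qed.

Lemma horner_prod_scaled (s : I -> R[i]) z :
  (\prod_k (b k *: 'X - (c k * s k)%:P)).[z] = \prod_k (b k * z - c k * s k).
Proof. by rewrite horner_prod; apply: eq_bigr => k _; rewrite !hornerE. Qed.

Lemma prod_sub_self (s : I -> R[i]) k : \prod_l (s k - s l) = 0.
Proof. by rewrite (bigD1 k) //= subrr mul0r. Qed.

Lemma deformed_defect (t : R[i]) (s : I -> R[i]) k : deformed t s -> defect id t s k = 0.
Proof.
move=> /(congr1 (fun p => p.[s k])).
rewrite !hornerE !horner_prod_XsubC horner_prod_scaled prod_sub_self mulr0 sub0r.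
by move=> H; rewrite /defect -H addNr.
Qed.

(** The difference of the two sides has degree less than the number of indices,
since \prod_k b_k = be matches the leading coefficients, and it vanishes at the
distinct points s_k. *)
Lemma defect_deformed (t : R[i]) (s : I -> R[i]) : \prod_i b i = be -> injective s ->
  (forall k, defect id t s k = 0) -> deformed t s.
Proof.
move=> bbe s_inj s0; rewrite /deformed.
set U := \prod_k ('X - (s k)%:P); set V := \prod_k (b k *: 'X - _).
set L := \prod_k ('X - (lam k)%:P).
have [sU cU] := size_coef_prod_XsubC s.
have [sV cV] := size_coef_prod_linear b (fun k => c k * s k).
have [sL cL] := size_coef_prod_XsubC lam.
rewrite -/U in sU cU; rewrite -/V bbe in sV cV; rewrite -/L in sL cL.
apply/eqP; rewrite -subr_eq0; apply/eqP.
set D := _ - _ - _.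
apply: (@roots_geq_poly_eq0 _ _ [seq s k | k <- enum I]).
- apply/allP => _ /mapP[k _ ->]; rewrite /root /D !hornerE !horner_prod_XsubC.
  rewrite horner_prod_scaled prod_sub_self mulr0 sub0r -opprD addrC.
  by have := s0 k; rewrite /defect => ->; rewrite oppr0.
- by rewrite map_inj_uniq ?enum_uniq.
rewrite size_map -cardE.
apply/leq_sizeP => j; rewrite leq_eqVlt => /orP[/eqP<-|jI].
  by rewrite !coefB !coefZ cU cV cL; ring.
by rewrite !coefB !coefZ !(nth_default _ (leq_trans _ jI)) //; ring.
Qed.

End DeformedFactorization.

(** * Newton iteration *)

Section Lipschitz.
Variables (R : realType) (I : finType) (lam : I -> R[i]).
Implicit Types (r rho : R) (s : I -> {poly R[i]}).

Definition in_polydisc r rho s := forall k, wnorm r (s k - (lam k)%:P) <= rho.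

(** The constant K must serve all radii r simultaneously: the radius is chosen
only after the Lipschitz constants are known. Keeping K as a bound for the
values too makes the notion stable under products. *)
Definition lipschitz (K : R) (g : (I -> {poly R[i]}) -> {poly R[i]}) : Prop :=
  0 <= K /\ forall r, 0 <= r ->
    (forall s, in_polydisc r 1 s -> wnorm r (g s) <= K) /\
    (forall s s' d, in_polydisc r 1 s -> in_polydisc r 1 s' -> 0 <= d ->
       (forall k, wnorm r (s k - s' k) <= d) -> wnorm r (g s - g s') <= K * d).

Lemma lipschitz_const (x : R[i]) : exists K, lipschitz K (fun=> x%:P).
Proof.
exists (normc x); split=> [|r r0]; first exact: normc_ge0.
split=> [s _|s s' d _ _ d0 sd]; first by rewrite wnormC.
by rewrite subrr -polyC0 wnormC normc0 mulr_ge0 ?normc_ge0.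
Qed.

Lemma lipschitz_coord k : exists K, lipschitz K (fun s => s k).
Proof.
have K0 := normc_ge0 (lam k).
exists (1 + normc (lam k)); split=> [|r r0]; first lra.
split=> [s sB|s s' d _ _ d0 sd]; last by have := sd k; nra.
have := wnormD (s k - (lam k)%:P) (lam k)%:P r0; rewrite subrK wnormC.
by have := sB k; lra.
Qed.

Lemma lipschitzD g h : (exists K, lipschitz K g) -> (exists K, lipschitz K h) ->
  exists K, lipschitz K (fun s => g s + h s).
Proof.
move=> [K [K0 gK]] [K' [K'0 hK]]; exists (K + K'); split=> [|r r0]; first lra.
have [gb gl] := gK r r0; have [hb hl] := hK r r0.
split=> [s sB|s s' d sB s'B d0 sd].
  exact: le_trans (wnormD _ _ r0) (lerD (gb _ sB) (hb _ sB)).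
rewrite opprD addrACA mulrDl.
exact: le_trans (wnormD _ _ r0) (lerD (gl _ _ _ sB s'B d0 sd) (hl _ _ _ sB s'B d0 sd)).
Qed.

Lemma lipschitzM g h : (exists K, lipschitz K g) -> (exists K, lipschitz K h) ->
  exists K, lipschitz K (fun s => g s * h s).
Proof.
move=> [K [K0 gK]] [K' [K'0 hK]].
have KK : 0 <= K * K' by rewrite mulr_ge0.
exists (2 * (K * K')); split=> [|r r0]; first lra.
have [gb gl] := gK r r0; have [hb hl] := hK r r0.
split=> [s sB|s s' d sB s'B d0 sd].
  have := ler_pM (wnorm_ge0 _ r0) (wnorm_ge0 _ r0) (gb _ sB) (hb _ sB).
  have := wnormM (g s) (h s) r0; lra.
have -> : g s * h s - g s' * h s' = (g s - g s') * h s + g s' * (h s - h s').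
  by ring.
have H1 := ler_pM (wnorm_ge0 _ r0) (wnorm_ge0 _ r0) (gl _ _ _ sB s'B d0 sd) (hb _ sB).
have H2 := ler_pM (wnorm_ge0 _ r0) (wnorm_ge0 _ r0) (gb _ s'B) (hl _ _ _ sB s'B d0 sd).
have := wnormD ((g s - g s') * h s) (g s' * (h s - h s')) r0.
have := wnormM (g s - g s') (h s) r0.
have := wnormM (g s') (h s - h s') r0.
lra.
Qed.

Lemma lipschitzN g : (exists K, lipschitz K g) ->
  exists K, lipschitz K (fun s => - g s).
Proof.
move=> [K [K0 gK]]; exists K; split=> // r r0; have [gb gl] := gK r r0.
split=> [s sB|s s' d sB s'B d0 sd]; first by rewrite wnormN gb.
by rewrite -opprD wnormN gl.
Qed.

Lemma lipschitz_prod (P : pred I) (g : I -> (I -> {poly R[i]}) -> {poly R[i]}) :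
  (forall l, exists K, lipschitz K (g l)) ->
  exists K, lipschitz K (fun s => \prod_(l | P l) g l s).
Proof.
move=> gK; elim: (index_enum I) => [|l ls [K HK]].
  have [K HK] := lipschitz_const 1; exists K.
  by under [X in lipschitz _ X]eq_fun => s do rewrite big_nil.
under [X in exists K, lipschitz _ X]eq_fun => s do rewrite big_cons.
case: (P l); last by exists K.
by apply: (lipschitzM (gK l)); exists K.
Qed.

Lemma lipschitz_uniform (g : I -> (I -> {poly R[i]}) -> {poly R[i]}) :
  (forall l, exists K, lipschitz K (g l)) ->
  exists2 K, 0 < K & forall l, lipschitz K (g l).
Proof.
move=> /choice[K HK]; have K0 l := (HK l).1.
exists (1 + \sum_l K l) => [|l].
  by rewrite ltr_wpDr // sumr_ge0.
have lK : K l <= 1 + \sum_l K l.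
  by rewrite (bigD1 l) //= addrCA lerDl addr_ge0 // sumr_ge0.
split=> [|r r0]; first exact: le_trans (K0 l) lK.
have [gb gl] := (HK l).2 r r0.
split=> [s sB|s s' d sB s'B d0 sd]; first exact: le_trans (gb _ sB) lK.
exact: le_trans (gl _ _ _ sB s'B d0 sd) (ler_wpM2r d0 lK).
Qed.

End Lipschitz.

Section NewtonContraction.
Variables (R : realType) (I : finType).
Variables (al be : R[i]) (b c lam : I -> R[i]).
Hypotheses (al0 : al != 0) (lam_inj : injective lam).

Let D k (s : I -> {poly R[i]}) := \prod_(l | l != k) (s k - (lam l)%:P).

(** The derivative of the k-th defect with respect to s_k, at t = 0 and s = lam;
the derivatives with respect to the other s_l vanish there. *)
Definition newton_slope k := al * \prod_(l | l != k) (lam k - lam l).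

Let kap k := (newton_slope k)^-1.

Definition newton_step (T : {poly R[i]}) (s : I -> {poly R[i]}) k :=
  s k - (kap k)%:P * defect al be b c lam polyC T s k.

Lemma newton_slope_neq0 k : newton_slope k != 0.
Proof.
rewrite mulf_neq0 //; apply/prodf_neq0 => l lk.
by rewrite subr_eq0; apply: contra lk => /eqP/lam_inj->.
Qed.

Lemma newton_step_polyC (t : R[i]) (s : I -> R[i]) k :
  newton_step t%:P (fun l => (s l)%:P) k
  = (s k - kap k * defect al be b c lam id t s k)%:P.
Proof. by rewrite /newton_step polyC_defect -polyCM -polyCB. Qed.

Let h k (s : I -> {poly R[i]}) :=
  (kap k)%:P * (be%:P * \prod_l (s k - (lam l)%:P)
                - \prod_l ((b l)%:P * s k - (c l)%:P * s l)).

(* The step splits into a part independent of T, which is stationary at lam, and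
   T times a polynomial map. *)
Let newton_stepE T s k : newton_step T s k =
  s k - (kap k * al)%:P * ((s k - (lam k)%:P) * D k s) + T * h k s.
Proof.
rewrite /newton_step /defect /h /D polyCM.
rewrite (bigD1 k (F := fun l => s k - (lam l)%:P)) //=.
set X := \prod_(l | _) _; set Y := \prod_(l : I) _.
ring.
Qed.

(** With K and K' Lipschitz constants of the two parts of the step, the first part
contracts by O(K rho) on the polydisc of radius rho because it is stationary at
lam, and the second by O(K' r0). *)
Lemma newton_contraction rho1 : 0 < rho1 -> exists rho r0 : R,
  [/\ 0 < rho, rho <= rho1, 0 < r0 &
  forall r T, 0 <= r -> wnorm r T <= r0 ->
    (forall k, wnorm r (newton_step T (fun l => (lam l)%:P) k - (lam k)%:P) <= rho / 2)
    /\ forall s s' d, in_polydisc lam r rho s -> in_polydisc lam r rho s' -> 0 <= d ->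
      (forall k, wnorm r (s k - s' k) <= d) ->
      forall k, wnorm r (newton_step T s k - newton_step T s' k) <= d / 2].
Proof.
move=> rho10.
have [K K0 DK] : exists2 K, 0 < K & forall k, lipschitz lam K
    (fun s => (kap k * al)%:P * D k s).
  apply: lipschitz_uniform => k; apply: lipschitzM; first exact: lipschitz_const.
  apply: lipschitz_prod => l; apply: lipschitzD; first exact: lipschitz_coord.
  by apply: lipschitzN; apply: lipschitz_const.
have [K' K'0 hK] : exists2 K, 0 < K & forall k, lipschitz lam K (h k).
  apply: lipschitz_uniform => k; apply: lipschitzM; first exact: lipschitz_const.
  apply: lipschitzD; last apply: lipschitzN.
    apply: lipschitzM; first exact: lipschitz_const.
    apply: lipschitz_prod => l; apply: lipschitzD; first exact: lipschitz_coord.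
    by apply: lipschitzN; apply: lipschitz_const.
  apply: lipschitz_prod => l; apply: lipschitzD; last apply: lipschitzN;
    by apply: lipschitzM; [apply: lipschitz_const | apply: lipschitz_coord].
pose rho := Num.min (Num.min 1 rho1) (1 / (8 * K)).
have rho0 : 0 < rho by rewrite !lt_min ltr01 rho10 divr_gt0 // mulr_gt0.
have [rho_1 rho_r1 rhoK] : [/\ rho <= 1, rho <= rho1 & K * rho <= 1 / 8].
  rewrite !ge_min !lexx !orbT; split=> //.
  by rewrite mulrC -ler_pdivlMr // ge_min invfM mulrA lexx orbT.
exists rho, (rho / (4 * K')); split=> //; first by rewrite divr_gt0 ?mulr_gt0.
move=> r T r0 Tr.
have TK : wnorm r T * K' <= rho / 4.
  have := ler_wpM2r (ltW K'0) Tr; suff -> : rho / (4 * K') * K' = rho / 4 by [].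
  by field; rewrite gt_eqF.
have T0 := wnorm_ge0 T r0.
have lamB : in_polydisc lam r 1 (fun l => (lam l)%:P).
  by move=> l; rewrite subrr -polyC0 wnormC normc0.
split=> [k|s s' d sB s'B d0 sd k].
  rewrite newton_stepE subrr mul0r mulr0 subr0 addrAC subrr add0r.
  apply: le_trans (wnormM _ _ r0) _.
  have := ler_wpM2l T0 (((hK k).2 r r0).1 _ lamB); lra.
have sB1 : in_polydisc lam r 1 s by move=> l; apply: le_trans (sB l) rho_1.
have s'B1 : in_polydisc lam r 1 s' by move=> l; apply: le_trans (s'B l) rho_1.
have H1 := ((DK k).2 r r0).2 _ _ _ sB1 s'B1 d0 sd.
have H2 := ((DK k).2 r r0).2 _ _ _ lamB sB1 (ltW rho0).
have H3 := ((hK k).2 r r0).2 _ _ _ sB1 s'B1 d0 sd.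
(* Each summand is a product of a factor of size d and a small factor. *)
have -> : newton_step T s k - newton_step T s' k =
  (s k - s' k) * ((kap k * al)%:P * D k (fun l => (lam l)%:P)
                  - (kap k * al)%:P * D k s)
  - (s' k - (lam k)%:P) * ((kap k * al)%:P * D k s - (kap k * al)%:P * D k s')
  + T * (h k s - h k s').
  have e1 : (kap k * al)%:P * D k (fun l => (lam l)%:P) = 1.
    rewrite /D; under eq_bigr do rewrite -polyCB.
    by rewrite -rmorph_prod -polyCM -mulrA mulVf // newton_slope_neq0.
  rewrite e1 !newton_stepE; ring.
apply: le_trans (wnormD _ _ r0) _.
apply: le_trans (lerD (wnormB _ _ r0) (lexx _)) _.
have {}H2 : wnorm r ((kap k * al)%:P * D k (fun l => (lam l)%:P)
                  - (kap k * al)%:P * D k s) <= 1 / 8.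
  apply: le_trans rhoK; apply: H2 => l; rewrite -wnormN opprB; exact: sB.
have M1 := wnormM (s k - s' k) ((kap k * al)%:P * D k (fun l => (lam l)%:P)
                  - (kap k * al)%:P * D k s) r0.
have M2 := wnormM (s' k - (lam k)%:P)
                  ((kap k * al)%:P * D k s - (kap k * al)%:P * D k s') r0.
have M3 := wnormM T (h k s - h k s') r0.
have N1 := ler_pM (wnorm_ge0 _ r0) (wnorm_ge0 _ r0) (sd k) H2.
have N2 := ler_pM (wnorm_ge0 _ r0) (wnorm_ge0 _ r0) (s'B k) H1.
have N3 := ler_wpM2l T0 H3.
have N2' : rho * (K * d) <= d / 8.
  have := ler_wpM2r d0 rhoK; lra.
have N3' : wnorm r T * (K' * d) <= d / 4.
  rewrite mulrA; have := ler_wpM2r d0 TK; have := ler_wpM2r d0 rho_1; lra.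
lra.
Qed.

End NewtonContraction.

(** * Local structure of the deformed factorizations *)

Section Deformation.
Variables (R : realType) (I : finType).
Variables (al be : R[i]) (b c lam : I -> R[i]).
Hypotheses (al0 : al != 0) (lam_inj : injective lam).

Lemma wnorm0_polyC (x : R[i]) (y : R[i]) : wnorm 0 (x%:P - y%:P) = normc (x - y).
Proof. by rewrite -polyCB wnormC. Qed.

Lemma newton_step_defect0 (t : R[i]) (s : I -> R[i]) k :
  newton_step al be b c lam t%:P (fun l => (s l)%:P) k = (s k)%:P <->
  defect al be b c lam id t s k = 0.
Proof.
rewrite newton_step_polyC; split=> [/polyC_inj/eqP|->]; last by rewrite mulr0 subr0.
rewrite -subr_eq0 addrAC subrr add0r oppr_eq0 mulf_eq0 invr_eq0.
by rewrite (negPf (newton_slope_neq0 al0 lam_inj k)) => /eqP.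
Qed.

(** The implicit function theorem for the defect equations. Applied to constant
polynomials the contraction shows that two solutions near lam are at distance
at most 2 rho / 2^p for all p. Applied with T = 'X, starting from lam, it produces
polynomials in t whose limit is the branch f. *)
Lemma deformation_local rho1 : 0 < rho1 -> exists rho r0 : R,
  [/\ 0 < rho, rho <= rho1, 0 < r0,
   forall (t : R[i]) (s s' : I -> R[i]), normc t <= r0 ->
     (forall k, normc (s k - lam k) <= rho) ->
     (forall k, normc (s' k - lam k) <= rho) ->
     (forall k, defect al be b c lam id t s k = 0) ->
     (forall k, defect al be b c lam id t s' k = 0) ->
     forall k, s k = s' k &
   exists f : I -> R[i] -> R[i],
     [/\ forall k, analytic_on (disc r0) (f k),
         forall k t, normc t < r0 -> normc (f k t - lam k) <= rho &
         forall t, normc t < r0 -> forall k,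
           defect al be b c lam id t (f^~ t) k = 0]].
Proof.
move=> rho10.
have [rho [r0 [rho0 rhor1 r00 H]]] :=
  newton_contraction be b c al0 lam_inj rho10.
exists rho, r0; split=> //.
  move=> t s s' tr sB s'B s0 s'0 k.
  have tw : wnorm 0 t%:P <= r0 by rewrite wnormC.
  have [_ Hc] := H 0 t%:P (lexx _) tw.
  have E p : forall k, wnorm 0 ((s k)%:P - (s' k)%:P) <= (2 * rho) / 2 ^+ p.
    elim: p => [|p IH] {}k.
      rewrite expr0 divr1 wnorm0_polyC.
      have := normc_triangle (lam k) (s k) (s' k).
      by have := sB k; have := s'B k; rewrite normcBC; lra.
    have sP : in_polydisc lam 0 rho (fun l => (s l)%:P).
      by move=> l; rewrite wnorm0_polyC.
    have s'P : in_polydisc lam 0 rho (fun l => (s' l)%:P).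
      by move=> l; rewrite wnorm0_polyC.
    have d0 : 0 <= 2 * rho / 2 ^+ p.
      by rewrite divr_ge0 ?exprn_ge0 // mulr_ge0 // ltW.
    have := Hc _ _ _ sP s'P d0 IH k.
    rewrite (newton_step_defect0 _ _ _).2 // (newton_step_defect0 _ _ _).2 //.
    by rewrite exprS invfM mulrA mulrAC.
  apply/eqP; rewrite -subr_eq0 -normc_eq0 eq_le normc_ge0 andbT.
  by apply: le_of_half_powers => p; rewrite -wnorm0_polyC; apply: E.
pose S := fix S p := if p is p'.+1 then newton_step al be b c lam 'X (S p')
                     else fun l => (lam l)%:P.
have Xw : wnorm r0 ('X : {poly R[i]}) <= r0 by rewrite wnormX.
have [Hl Hc] := H r0 'X (ltW r00) Xw.
have lamB : in_polydisc lam r0 rho (S 0%N).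
  by move=> l; rewrite /= subrr -polyC0 wnormC normc0 ltW.
have SB p : in_polydisc lam r0 rho (S p).
  elim: p => // p IH k /=.
  have := Hc _ _ rho IH lamB (ltW rho0) IH k.
  have := wnormD (newton_step al be b c lam 'X (S p) k -
    newton_step al be b c lam 'X (S 0%N) k)
    (newton_step al be b c lam 'X (S 0%N) k - (lam k)%:P) (ltW r00).
  rewrite subrKA; have := Hl k; rewrite /=; lra.
have SC p k : wnorm r0 (S p.+1 k - S p k) <= rho / 2 / 2 ^+ p.
  elim: p k => [|p IH] k; first by rewrite expr0 divr1; apply: Hl.
  have d0 : 0 <= rho / 2 / 2 ^+ p by rewrite !divr_ge0 ?exprn_ge0 // ltW.
  have := Hc _ _ _ (SB p.+1) (SB p) d0 IH k.
  by rewrite exprS invfM mulrA mulrAC.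
have /choice[f Hf] k := analytic_limit (SC^~ k).
have fS k t p : normc t < r0 -> normc (f k t - (S p k).[t]) <= 2 * rho / 2 ^+ p.
  move=> tr; have := (Hf k).2 t tr p.
  by have -> : 4 * (rho / 2) = 2 * rho by field.
have SBt k t p : normc t < r0 -> normc ((S p k).[t] - lam k) <= rho.
  move=> tr; apply: le_trans (SB p k).
  have -> : (S p k).[t] - lam k = (S p k - (lam k)%:P).[t] by rewrite !hornerE.
  by rewrite wnorm_horner // ltW.
have fB k t : normc t < r0 -> normc (f k t - lam k) <= rho.
  move=> tr; rewrite -subr_le0; apply: (@le_of_half_powers _ _ (2 * rho)) => p.
  have := fS k t p tr; have := SBt k t p tr.
  have := normc_triangle (S p k).[t] (f k t) (lam k); lra.
exists f; split=> // [k|t tr k]; first exact: (Hf k).1.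
apply/newton_step_defect0.
have tw : wnorm 0 t%:P <= r0 by rewrite wnormC ltW.
have [_ Hc0] := H 0 t%:P (lexx _) tw.
rewrite newton_step_polyC; congr _%:P; apply/eqP; rewrite -subr_eq0 -normc_eq0.
rewrite eq_le normc_ge0 andbT.
apply: (@le_of_half_powers _ _ (2 * rho)) => p.
have d0 : 0 <= 2 * rho / 2 ^+ p by rewrite divr_ge0 ?exprn_ge0 // mulr_ge0 // ltW.
have := Hc0 (fun l => (f l t)%:P) (fun l => (S p l).[t]%:P) (2 * rho / 2 ^+ p).
have fP : in_polydisc lam 0 rho (fun l => (f l t)%:P).
  by move=> l; rewrite wnorm0_polyC fB.
have SP : in_polydisc lam 0 rho (fun l => (S p l).[t]%:P).
  by move=> l; rewrite wnorm0_polyC SBt.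
have fSP l : wnorm 0 ((f l t)%:P - (S p l).[t]%:P) <= 2 * rho / 2 ^+ p.
  by rewrite wnorm0_polyC fS.
move=> /(_ fP SP d0 fSP k); rewrite !newton_step_polyC wnorm0_polyC.
have <- : (S p.+1 k).[t] = (S p k).[t] - (newton_slope al lam k)^-1 *
   defect al be b c lam id t (fun l => (S p l).[t]) k.
  by rewrite /= /newton_step hornerD hornerN hornerM hornerC horner_defect hornerX.
set y := f k t - _ in |- *; set z := (S p.+1 k).[t] => H1.
have := fS k t p.+1 tr; rewrite exprS invfM normcBC -/z => H2.
have := normc_triangle z y (f k t); lra.
Qed.

(** No solution escapes to infinity as t tends to 0, and every lam_k attracts
some s_l; as the lam_k are separated, the choice of l is injective. *)
Lemma deformation_localised rho : 0 < rho ->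
  exists2 r0 : R, 0 < r0 & forall (t : R[i]) (s : I -> R[i]), normc t < r0 ->
    deformed al be b c lam t s ->
    exists2 sigma : I -> I, injective sigma &
      forall k, normc (s (sigma k) - lam k) < rho.
Proof.
move=> rho0; have [g g0 Hg] := separation lam_inj.
have [e e0 [er eg]] : exists2 e, 0 < e & e <= rho /\ 2 * e <= g.
  exists (Num.min rho (g / 2)); first by rewrite lt_min rho0 divr_gt0.
  split; first by rewrite ge_min lexx.
  have : Num.min rho (g / 2) <= g / 2 by rewrite ge_min lexx orbT.
  lra.
have [B B0 HB] : exists2 B, 0 < B & forall l, normc (b l) + normc (c l) <= B.
  exists (1 + \sum_l (normc (b l) + normc (c l))).
    by rewrite ltr_wpDr // sumr_ge0 // => l _; rewrite addr_ge0 ?normc_ge0.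
  move=> l; rewrite (bigD1 l) //= addrCA lerDl addr_ge0 // sumr_ge0 // => l' _.
  by rewrite addr_ge0 ?normc_ge0.
have [A A0 HA] : exists2 A, 0 < A & forall l, normc (lam l) <= A.
  exists (1 + \sum_l normc (lam l)).
    by rewrite ltr_wpDr // sumr_ge0 // => l _; rewrite normc_ge0.
  move=> l; rewrite (bigD1 l) //= addrCA lerDl addr_ge0 // sumr_ge0 // => l' _.
  by rewrite normc_ge0.
have nal : 0 < normc al by rewrite normc_gt0.
pose N := #|I|.
have [r0 r00 [r1 r2]] : exists2 r0 : R, 0 < r0 &
    r0 * (normc be + (2 * B) ^+ N) <= normc al /\
    r0 * (2 * A * B) ^+ N <= normc al * e ^+ N.
  have p1 : 0 < normc be + (2 * B) ^+ N.
    by rewrite ltr_wpDl ?normc_ge0 // exprn_gt0 // mulr_gt0.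
  have p2 : 0 < (2 * A * B) ^+ N by rewrite exprn_gt0 // !mulr_gt0.
  have p3 : 0 < normc al * e ^+ N by rewrite mulr_gt0 // exprn_gt0.
  exists (Num.min (normc al / (normc be + (2 * B) ^+ N))
                  (normc al * e ^+ N / (2 * A * B) ^+ N)).
    by rewrite lt_min !divr_gt0.
  by rewrite -!ler_pdivlMr // !ge_min !lexx orbT.
exists r0 => // t s tr ts.
have Vbound (z : R[i]) rm : 0 <= rm -> normc z <= rm -> (forall l, normc (s l) <= rm) ->
    normc (\prod_l (b l * z - c l * s l)) <= (B * rm) ^+ N.
  move=> rm0 zr sr; rewrite normc_prod /N -prodr_const; apply: ler_prod => l _.
  rewrite normc_ge0; apply: le_trans (normcB _ _) _; rewrite !normcM.
  have := ler_pM (normc_ge0 _) (normc_ge0 _) (lexx (normc (b l))) zr.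
  have := ler_pM (normc_ge0 _) (normc_ge0 _) (lexx (normc (c l))) (sr l).
  have := ler_wpM2r rm0 (HB l); lra.
(* For s_k0 of maximal modulus rm > 2 A, all |s_k0 - lam_l| are at least rm / 2,
   and rm^N cancels from the two sides of the defect equation. *)
have s_bound k : normc (s k) <= 2 * A.
  have [k0 _ kmax] :=
    @Order.TotalTheory.arg_maxP _ _ I k xpredT (fun k => normc (s k)) erefl.
  apply: le_trans (kmax k erefl) _; rewrite /= leNgt; apply/negP => big.
  set rm := normc (s k0) in big.
  have rm0 : 0 < rm by lra.
  have /eqP := deformed_defect k0 ts; rewrite /defect addr_eq0 => /eqP H.
  have Lb : (rm / 2) ^+ N <= normc (\prod_l (s k0 - lam l)).
    rewrite normc_prod /N -prodr_const; apply: ler_prod => l _.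
    apply/andP; split; first lra.
    have := normcD (s k0 - lam l) (lam l); rewrite subrK -/rm.
    have := HA l; lra.
  have Vb := Vbound (s k0) rm (ltW rm0) (lexx _) (fun l => kmax l erefl).
  have := congr1 (@normc R) H; rewrite normc_opp !normcM => H2.
  have h1 : normc al - normc t * normc be <= normc (al - t * be).
    by have := normcD (al - t * be) (t * be); rewrite subrK normcM; lra.
  have h2 : 0 < rm ^+ N by rewrite exprn_gt0.
  have h3 : normc (al - t * be) * rm ^+ N <= normc t * (2 * B) ^+ N * rm ^+ N.
    have -> : normc t * (2 * B) ^+ N * rm ^+ N = 2 ^+ N * (normc t * (B * rm) ^+ N).
      by rewrite !exprMn; ring.
    have <- : 2 ^+ N * (normc (al - t * be) * (rm / 2) ^+ N)
              = normc (al - t * be) * rm ^+ N.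
      rewrite exprMn exprVn mulrCA (mulrCA (2 ^+ N)) divff ?mulr1 //.
      by rewrite expf_neq0 ?pnatr_eq0.
    rewrite ler_wpM2l ?exprn_ge0 //.
    apply: le_trans (ler_wpM2l (normc_ge0 _) Lb) _; rewrite H2.
    by rewrite ler_wpM2l ?normc_ge0.
  rewrite ler_pM2r // in h3.
  have h4 : normc t * (normc be + (2 * B) ^+ N) < r0 * (normc be + (2 * B) ^+ N).
    by rewrite ltr_pM2r // ltr_wpDl ?normc_ge0 // exprn_gt0 // mulr_gt0.
  lra.
(* If all s_l were far from lam_k, the first product would be too large at
   lam_k, where the right-hand side vanishes. *)
have /choice[sigma Hs] k : exists l, normc (s l - lam k) < e.
  apply: contrapT => /forallNP far.
  have /(congr1 (fun p => p.[lam k])) := ts.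
  rewrite !hornerE !horner_prod_XsubC horner_prod_scaled prod_sub_self mulr0.
  move=> /eqP; rewrite subr_eq0 => /eqP /(congr1 (@normc R)); rewrite !normcM => H.
  have A20 : 0 <= 2 * A by lra.
  have lamA : normc (lam k) <= 2 * A by have := HA k; lra.
  have Vb := Vbound (lam k) (2 * A) A20 lamA s_bound.
  have Ub : e ^+ N <= normc (\prod_l (lam k - s l)).
    rewrite normc_prod /N -prodr_const; apply: ler_prod => l _.
    rewrite ltW //= normcBC leNgt; apply/negP; exact: far.
  have := ler_wpM2l (ltW nal) Ub; rewrite H => H'.
  have := ler_wpM2l (normc_ge0 t) Vb; rewrite mulrC in r2 *.
  have : normc t * (B * (2 * A)) ^+ N < r0 * (B * (2 * A)) ^+ N.
    by rewrite ltr_pM2r // exprn_gt0 // !mulr_gt0.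
  rewrite (mulrC B) => h5; lra.
exists sigma => [k k' kk'|k]; last by have := Hs k; lra.
apply/eqP; apply/negPn/negP => /Hg.
have := Hs k; have := Hs k'; rewrite -kk'.
have := normc_triangle (s (sigma k)) (lam k) (lam k').
rewrite (normcBC (lam k) (s _)); lra.
Qed.

End Deformation.

(** * Zeros of complex polynomials *)

Section Splitting.
Variable R : realType.

Lemma prod_enum_rank (I : finType) (rs : seq R[i]) (A : comNzRingType) (G : R[i] -> A) :
  seq.size rs = #|I| -> \prod_(x <- rs) G x = \prod_(k : I) G (nth 0 rs (enum_rank k)).
Proof.
move=> sz; rewrite (big_nth 0) sz big_mkord.
by rewrite (reindex (@enum_rank I)) //; apply: onW_bij; apply: enum_rank_bij.
Qed.

Lemma poly_split (I : finType) (p : {poly R[i]}) : size p = #|I|.+1 ->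
  exists s : I -> R[i], p = lead_coef p *: \prod_k ('X - (s k)%:P).
Proof.
move=> sp; have [rs Hp] := closed_field_poly_normal p.
have p0 : lead_coef p != 0 by rewrite lead_coef_eq0 -size_poly_eq0 sp.
have sz : seq.size rs = #|I|.
  by move: sp; rewrite Hp size_scale // size_prod_XsubC => -[].
exists (fun k => nth 0 rs (enum_rank k)).
by rewrite {1}Hp; congr (_ *: _); apply: prod_enum_rank.
Qed.

Lemma separable_prod_injective (I : finType) (s : I -> R[i]) :
  separable_poly (\prod_k ('X - (s k)%:P)) -> injective s.
Proof.
have -> : \prod_k ('X - (s k)%:P) = \prod_(x <- codom s) ('X - x%:P).
  by rewrite /codom big_map big_enum.
by rewrite separable_prod_XsubC => /injectiveP.
Qed.

Lemma same_roots_perm (I : finType) (s s' : I -> R[i]) : injective s ->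
  \prod_k ('X - (s k)%:P) = \prod_k ('X - (s' k)%:P) ->
  exists sigma : {perm I}, forall k, s k = s' (sigma k).
Proof.
move=> s_inj E.
have /choice[f Hf] k : exists l, s k = s' l.
  have : (\prod_k ('X - (s' k)%:P)).[s k] = 0.
    by rewrite -E horner_prod_XsubC prod_sub_self.
  rewrite horner_prod_XsubC => /eqP/prodf_eq0[l _].
  by rewrite subr_eq0 => /eqP; exists l.
have f_inj : injective f by move=> k l fkl; apply: s_inj; rewrite !Hf fkl.
by exists (perm f_inj) => k; rewrite permE.
Qed.

End Splitting.

(** * The QQ-system as a deformed factorization *)

Section QQRoots.
Variables (R : realType) (q : R[i]) (m n : nat).
Hypothesis q_neq0 : q != 0.
Local Notation I := ('I_m + 'I_n)%type.

(** The zeros of [qshift q (Qplus x)] and of the other factor, over one index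
type. *)
Definition QQ_roots (x : 'I_m -> R[i]) (y : 'I_n -> R[i]) (k : I) : R[i] :=
  match k with inl i => - x i / q | inr j => - y j end.

Definition numer_scale (k : I) : R[i] := if k is inl _ then 1 else q.
Definition root_scale (k : I) : R[i] := if k is inl _ then q else 1.

Lemma prod_numer_scale : \prod_k numer_scale k = q ^+ n.
Proof. by rewrite big_sumType /= big1_eq mul1r prodr_const card_ord. Qed.

Lemma QQ_rootsK (s : I -> R[i]) :
  QQ_roots (fun i => - q * s (inl i)) (fun j => - s (inr j)) =1 s.
Proof.
by case=> [i|j] /=; rewrite ?opprK // -mulNr opprK mulrC mulKf.
Qed.

Lemma qshift_prod_XsubC (J : finType) (w : J -> R[i]) :
  qshift q (\prod_k ('X - (w k)%:P)) = q ^+ #|J| *: \prod_k ('X - (w k / q)%:P).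
Proof.
rewrite /qshift (big_morph (fun p => p \Po (q *: 'X)) (id1 := 1) (op1 := *%R)).
- under eq_bigr => k _.
    rewrite comp_polyB comp_polyX comp_polyC.
    have -> : q *: 'X - (w k)%:P = q%:P * ('X - (w k / q)%:P).
      by rewrite mulrBr mul_polyC -polyCM mulrC divfK.
    over.
  by rewrite big_split /= prodr_const -rmorphXn mul_polyC.
- by move=> p p'; apply: comp_polyM.
- by rewrite -polyC1 comp_polyC.
Qed.

Lemma QplusE (x : 'I_m -> R[i]) : Qplus x = \prod_i ('X - (- x i)%:P).
Proof. by apply: eq_bigr => i _; rewrite polyCN opprK. Qed.

Lemma QQ_product (x : 'I_m -> R[i]) (y : 'I_n -> R[i]) :
  qshift q (Qplus x) * \prod_(j < n) ('X + (y j)%:P)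
  = q ^+ m *: \prod_k ('X - (QQ_roots x y k)%:P).
Proof.
rewrite QplusE qshift_prod_XsubC card_ord -scalerAl big_sumType /=.
by congr (_ *: (_ * _)); apply: eq_bigr => j _; rewrite polyCN opprK.
Qed.

Lemma QQ_swapped_product (x : 'I_m -> R[i]) (y : 'I_n -> R[i]) :
  Qplus x * qshift q (\prod_(j < n) ('X + (y j)%:P))
  = \prod_k (numer_scale k *: 'X - (root_scale k * QQ_roots x y k)%:P).
Proof.
rewrite big_sumType /=; congr (_ * _).
  by apply: eq_bigr => i _; rewrite scale1r mulrC divfK // polyCN opprK.
have -> : \prod_(j < n) ('X + (y j)%:P) = \prod_(j < n) ('X - (- y j)%:P).
  by apply: eq_bigr => j _; rewrite polyCN opprK.
rewrite qshift_prod_XsubC card_ord.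
have -> : q ^+ n = \prod_(j < n) q by rewrite prodr_const card_ord.
rewrite -mul_polyC rmorph_prod -big_split /=; apply: eq_bigr => j _.
by rewrite mulrBr mul_polyC -polyCM mulrC divfK // mul1r.
Qed.

Lemma finite_QQ_scaled t mu L x y :
  finite_QQ q t L (Qplus x) (mu *: \prod_(j < n) ('X + (y j)%:P)) <->
  mu *: (q ^+ m *: \prod_k ('X - (QQ_roots x y k)%:P)
   - t *: \prod_k (numer_scale k *: 'X - (root_scale k * QQ_roots x y k)%:P)) = L.
Proof.
rewrite /finite_QQ -QQ_product -QQ_swapped_product.
have -> : qshift q (mu *: \prod_(j < n) ('X + (y j)%:P))
          = mu *: qshift q (\prod_(j < n) ('X + (y j)%:P)).
  by rewrite /qshift comp_polyZ.
by rewrite -!scalerAr scalerBr !scalerA (mulrC mu).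
Qed.

(** When q^m = t q^n the left-hand side is 0 by the convention on inverses,
whereas L is monic. *)
Lemma finite_QQ_deformed t x y (lam : I -> R[i]) :
  finite_QQ q t (\prod_k ('X - (lam k)%:P)) (Qplus x) (Qminus q t m y) <->
  q ^+ m - t * q ^+ n != 0 /\
  deformed (q ^+ m) (q ^+ n) numer_scale root_scale lam t (QQ_roots x y).
Proof.
rewrite /Qminus finite_QQ_scaled /deformed.
have L0 : \prod_k ('X - (lam k)%:P) != 0.
  by apply/monic_neq0/monic_prod => k _; apply: monicXsubC.
have [->|ct0] := eqVneq (q ^+ m - t * q ^+ n) 0.
  by split=> [H|[]//]; rewrite invr0 scale0r in H; rewrite -H eqxx in L0.
split=> [<-|[_ ->]]; last by rewrite scalerA mulVf // scale1r.
by rewrite scalerA divff // scale1r.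
Qed.

Lemma infinite_solution_roots L x y :
  infinite_solution q L x y <-> \prod_k ('X - (QQ_roots x y k)%:P) = L.
Proof.
rewrite /infinite_solution /infinite_QQ -scalerAr QQ_product scalerA mulVf.
  by rewrite scale1r.
by rewrite expf_neq0.
Qed.

End QQRoots.

(** * Branches of solutions *)

Section Branches.
Variables (R : realType) (q : R[i]) (m n : nat) (L : {poly R[i]}).
Hypotheses (q_neq0 : q != 0) (L_simple : separable_poly L).
Local Notation I := ('I_m + 'I_n)%type.
Local Notation numers := (@numer_scale R q m n).
Local Notation scales := (@root_scale R q m n).

Lemma infinite_solution_injective (x0 : 'I_m -> R[i]) (y0 : 'I_n -> R[i]) :
  infinite_solution q L x0 y0 -> injective (QQ_roots q x0 y0).
Proof.
move=> /(infinite_solution_roots q_neq0) H; apply: separable_prod_injective.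
by rewrite H.
Qed.

(** The branch of the deformed factorization starting at the zeros of L. The radius
is reduced so that q^m - t q^n does not vanish, and rho <= g / 3 keeps the
zeros distinct, as [defect_deformed] requires. *)
Lemma QQ_branches (x0 : 'I_m -> R[i]) (y0 : 'I_n -> R[i]) :
  infinite_solution q L x0 y0 ->
  exists (eps : R) (x : 'I_m -> R[i] -> R[i]) (y : 'I_n -> R[i] -> R[i]),
    analytic_solution q L x0 y0 eps x y.
Proof.
move=> sol0; set lam := QQ_roots q x0 y0.
have lam_inj : injective lam := infinite_solution_injective sol0.
have Llam : \prod_k ('X - (lam k)%:P) = L.
  by apply/(infinite_solution_roots q_neq0).
have al0 : q ^+ m != 0 by rewrite expf_neq0.
have be0 : q ^+ n != 0 by rewrite expf_neq0.
have [g g0 Hg] := separation lam_inj.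
have g3 : 0 < g / 3 by rewrite divr_gt0.
have [rho [r0 [rho0 rhog r00 uniq_loc [f [f_an f_near f_sol]]]]] :=
  deformation_local (q ^+ n) numers
    scales al0 lam_inj g3.
have f_inj t : normc t < r0 -> injective (f^~ t).
  move=> tr k l /= fkl; apply/eqP/negPn/negP => /Hg.
  have := f_near k t tr; have := f_near l t tr; rewrite -fkl.
  have := normc_triangle (f k t) (lam k) (lam l).
  rewrite (normcBC (lam k) (f k t)); lra.
have f0 k : f k 0 = lam k.
  have z0 : normc (0 : R[i]) < r0 by rewrite normc0.
  apply: (uniq_loc 0 (f^~ 0) lam (ltW z0)) => l.
  - exact: f_near.
  - by rewrite subrr normc0 ltW.
  - exact: f_sol.
  - by rewrite /defect /= prod_sub_self mulr0 mul0r addr0.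
pose eps := Num.min r0 (normc (q ^+ m) / normc (q ^+ n)).
have [eps_r0 eps_q] : eps <= r0 /\ eps <= normc (q ^+ m) / normc (q ^+ n).
  by rewrite !ge_min !lexx orbT.
have an0 k z : analytic_on (disc eps) (fun t => z * f k t).
  apply: analytic_on_scale (f_an k) => t /discE te; apply/discE; lra.
exists eps, (fun i t => - q * f (inl i) t), (fun j t => - f (inr j) t).
split.
- by rewrite lt_min r00 divr_gt0 ?normc_gt0.
- move=> i; split; first exact: an0.
  by rewrite f0 /lam /= mulrC -mulrA mulrN mulVf // mulrN1 opprK.
- move=> j; split; last by rewrite f0 /lam /= opprK.
  rewrite (_ : (fun t => - f (inr j) t) = (fun t => -1 * f (inr j) t)) //.
  by apply/funext => t; rewrite mulN1r.
move=> t /discE te; have tr : normc t < r0 by lra.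
rewrite -Llam; apply/(finite_QQ_deformed q_neq0); split.
  rewrite subr_eq0; apply/eqP => /(congr1 (@normc R)); rewrite normcM => E.
  have : normc t < normc (q ^+ m) / normc (q ^+ n) by lra.
  by rewrite ltr_pdivlMr ?normc_gt0 // -E ltxx.
rewrite (_ : QQ_roots _ _ _ = f^~ t); last first.
  by apply/funext => k; rewrite (QQ_rootsK q_neq0 (f^~ t)).
apply: defect_deformed; [exact: prod_numer_scale|exact: f_inj|].
by move=> k; apply: f_sol.
Qed.

Lemma branch_near (x0 : 'I_m -> R[i]) (y0 : 'I_n -> R[i]) eps x y (rho : R) :
  analytic_solution q L x0 y0 eps x y -> 0 < rho ->
  exists2 delta : R, 0 < delta & forall t, normc t < delta ->
    normc t < eps /\
    forall k, normc (QQ_roots q (x^~ t) (y^~ t) k - QQ_roots q x0 y0 k) <= rho.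
Proof.
move=> [eps0 x_an y_an _] rho0.
have z0 : disc eps (0 : R[i]) by apply/discE; rewrite normc0.
have [||d d0 Hd] := @uniform_pos R I (fun k d => forall t, normc t < d ->
    normc (QQ_roots q (x^~ t) (y^~ t) k - QQ_roots q x0 y0 k) <= rho).
- case=> [i|j].
    have nq : 0 < normc q by rewrite normc_gt0.
    have [xi_an xi0] := x_an i.
    have [d d0 Hd] := analytic_continuous xi_an z0 (mulr_gt0 rho0 nq).
    exists d => // t td /=; rewrite -mulrBl normcM normcV.
    have := Hd t; rewrite subr0 xi0 => /(_ td) Hxi.
    by rewrite ler_pdivrMr // ltW // -opprD normc_opp.
  have [yj_an yj0] := y_an j.
  have [d d0 Hd] := analytic_continuous yj_an z0 rho0.
  exists d => // t td /=; rewrite -opprD normc_opp.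
  by have := Hd t; rewrite subr0 yj0 => /(_ td) /ltW.
- by move=> k d e _ ed H t te; apply: H; lra.
exists (Num.min d eps); first by rewrite lt_min d0.
by move=> t; rewrite lt_min => /andP[td te]; split=> // k; apply: Hd.
Qed.

End Branches.

Section Exhaustion.
Variables (R : realType) (q : R[i]) (m n : nat) (L : {poly R[i]}).
Hypotheses (q_neq0 : q != 0) (L_monic : L \is monic).
Hypotheses (L_size : size L = (m + n).+1) (L_simple : separable_poly L).
Local Notation I := ('I_m + 'I_n)%type.
Local Notation numers := (@numer_scale R q m n).
Local Notation scales := (@root_scale R q m n).

Lemma QQ_roots_inj (x x' : 'I_m -> R[i]) (y y' : 'I_n -> R[i]) :
  QQ_roots q x y =1 QQ_roots q x' y' -> x = x' /\ y = y'.
Proof.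
move=> E; split; apply/funext => i.
- by have /= := E (inl i); move=> /(divIf q_neq0)/oppr_inj.
- by have /= := E (inr i); move=> /oppr_inj.
Qed.

Variables (eps : ('I_m -> R[i]) -> ('I_n -> R[i]) -> R)
  (x : ('I_m -> R[i]) -> ('I_n -> R[i]) -> 'I_m -> R[i] -> R[i])
  (y : ('I_m -> R[i]) -> ('I_n -> R[i]) -> 'I_n -> R[i] -> R[i]).
Hypothesis branches : forall x0 y0, infinite_solution q L x0 y0 ->
  analytic_solution q L x0 y0 (eps x0 y0) (x x0 y0) (y x0 y0).

(** The infinite system has finitely many solutions, one for each permutation of
a fixed list of zeros of L, so one radius serves all of them. A
branch is continuous at 0, hence for small t lies in the polydisc where solutions
are unique; any other solution is brought there by [deformation_localised]. *)
Lemma branches_exhaust : exists2 delta : R, 0 < delta &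
  forall t, normc t < delta ->
    (forall x1 y1, finite_QQ q t L (Qplus x1) (Qminus q t m y1) ->
       exists x0 y0, [/\ infinite_solution q L x0 y0, normc t < eps x0 y0,
         x1 = (fun i => x x0 y0 i t) & y1 = (fun j => y x0 y0 j t)]) /\
    (forall x0 y0, infinite_solution q L x0 y0 ->
       normc t < eps x0 y0 /\ injective (fun i => x x0 y0 i t)).
Proof.
have cI : #|{: I}| = (m + n)%N by rewrite card_sum !card_ord.
have [lam0] : exists lam0 : I -> R[i],
    L = lead_coef L *: \prod_k ('X - (lam0 k)%:P).
  by apply: poly_split; rewrite L_size cI.
rewrite (monicP L_monic) scale1r => Llam.
have lam0_inj : injective lam0 by apply: separable_prod_injective; rewrite -Llam.
have al0 : q ^+ m != 0 by rewrite expf_neq0.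
have [g g0 Hg] := separation lam0_inj.
pose lam (s : {perm I}) k := lam0 (s k).
have lam_inj s : injective (lam s) by move=> k l /lam0_inj/perm_inj.
pose xs s i := - q * lam s (inl i); pose ys s j := - lam s (inr j).
have rootsE s : QQ_roots q (xs s) (ys s) = lam s.
  by apply/funext => k; rewrite /xs /ys (QQ_rootsK q_neq0 (lam s)).
have Lsig s : L = \prod_k ('X - (lam s k)%:P).
  by rewrite Llam (reindex_inj (@perm_inj _ s)).
have sol s : infinite_solution q L (xs s) (ys s).
  by apply/(infinite_solution_roots q_neq0); rewrite rootsE -Lsig.
pose unique_at s rho t := forall s1 s2 : I -> R[i],
  (forall k, normc (s1 k - lam s k) <= rho) ->
  (forall k, normc (s2 k - lam s k) <= rho) ->
  (forall k, defect (q ^+ m) (q ^+ n) numers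
    scales (lam s) id t s1 k = 0) ->
  (forall k, defect (q ^+ m) (q ^+ n) numers
    scales (lam s) id t s2 k = 0) -> s1 =1 s2.
have [||rho1 rho10 Hrho1] := @uniform_pos R {perm I} (fun s rho =>
    exists2 r : R, 0 < r & forall t, normc t < r -> unique_at s rho t).
- move=> s.
  have [rho [r [rho0 _ r0 uniq_loc _]]] :=
    deformation_local (q ^+ n) numers
      scales al0 (@lam_inj s) (@ltr01 R).
  exists rho => //; exists r => // t /ltW tr s1 s2; exact: uniq_loc.
- move=> s d e _ ed [r r0 H]; exists r => // t tr s1 s2 h1 h2.
  by apply: (H t tr) => k; [have := h1 k | have := h2 k]; lra.
pose rho := Num.min rho1 (g / 3).
have rho0 : 0 < rho by rewrite lt_min rho10 divr_gt0.
have [rho_1 rho_g] : rho <= rho1 /\ rho <= g / 3 by rewrite !ge_min !lexx orbT.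
have [||d1 d10 Hd1] := @uniform_pos R {perm I} (fun s d =>
    forall t, normc t < d -> [/\ unique_at s rho1 t, normc t < eps (xs s) (ys s) &
      forall k, normc (QQ_roots q (fun i => x (xs s) (ys s) i t)
                         (fun j => y (xs s) (ys s) j t) k - lam s k) <= rho]).
- move=> s; have [r r0 Hr] := Hrho1 s.
  have [d d0 Hd] := branch_near q_neq0 (branches (sol s)) rho0.
  exists (Num.min r d) => [|t]; first by rewrite lt_min r0.
  rewrite lt_min => /andP[tr td]; have [te tn] := Hd t td.
  by split=> // [|k]; [exact: Hr | rewrite -rootsE].
- by move=> s d e _ ed H t te; apply: H; lra.
have [d2 d20 Hd2] := deformation_localised (q ^+ n)
  numers scales
  al0 lam0_inj rho0.
exists (Num.min d1 d2) => [|t]; first by rewrite lt_min d10.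
rewrite lt_min => /andP[td1 td2]; split.
  move=> x1 y1 QQ1.
  have def1 : deformed (q ^+ m) (q ^+ n) numers
      scales lam0 t (QQ_roots q x1 y1).
    by move: QQ1; rewrite Llam => /(finite_QQ_deformed q_neq0)[].
  have [f f_inj Hf] := Hd2 t _ td2 def1.
  pose s := ((perm f_inj)^-1)%g.
  have [Hu te Hn] := Hd1 s t td1.
  have E : QQ_roots q x1 y1 =1 QQ_roots q (fun i => x (xs s) (ys s) i t)
                         (fun j => y (xs s) (ys s) j t).
    apply: Hu => k.
    - have := Hf (s k); rewrite -[f (s k)](permE f_inj) permKV /lam; lra.
    - have := Hn k; lra.
    - apply: deformed_defect; move: QQ1.
      by rewrite (Lsig s) => /(finite_QQ_deformed q_neq0)[].
    - apply: deformed_defect; have [_ _ _ /(_ t)] := branches (sol s).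
      move=> /(_ ((discE _ _).2 te)).
      by rewrite {1}(Lsig s) => /(finite_QQ_deformed q_neq0)[].
  have [-> ->] := QQ_roots_inj E.
  by exists (xs s), (ys s).
move=> x0 y0 sol0.
have [s Hs] : exists s : {perm I}, forall k, QQ_roots q x0 y0 k = lam0 (s k).
  apply: same_roots_perm; first exact: infinite_solution_injective sol0.
  by rewrite -Llam; apply/(infinite_solution_roots q_neq0).
have [-> ->] : x0 = xs s /\ y0 = ys s.
  by apply: QQ_roots_inj => k; rewrite rootsE Hs.
have [_ te Hn] := Hd1 s t td1; split=> // i i' /= ii'.
have := Hn (inl i'); have := Hn (inl i); rewrite /= -ii'; set z := - _ / q.
move=> H1 H2; suff : s (inl i) == s (inl i') by rewrite (inj_eq perm_inj) => /eqP[].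
apply/negPn/negP => /Hg; rewrite -/(lam s (inl i)) -/(lam s (inl i')).
have := normc_triangle z (lam s (inl i)) (lam s (inl i')).
rewrite (normcBC (lam s (inl i)) z); lra.
Qed.

End Exhaustion.

(** * From Bethe equations to the QQ-system *)

Section Interpolation.
Variable F : fieldType.

(** Lagrange interpolation; the degree bound comes for free by reducing modulo
the polynomial that vanishes at the nodes. *)
Lemma interpolation (J : finType) (w v : J -> F) : injective w ->
  exists M : {poly F}, (size M <= #|J|)%N /\ forall k, M.[w k] = v k.
Proof.
move=> w_inj; pose Q := \prod_k ('X - (w k)%:P).
have Q0 : Q != 0 by apply/monic_neq0/monic_prod => k _; apply: monicXsubC.
have Qw k : Q.[w k] = 0.
  by rewrite /Q horner_prod (bigD1 k) //= !hornerE subrr mul0r.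
pose M := \sum_k (v k / \prod_(l | l != k) (w k - w l)) *:
                  \prod_(l | l != k) ('X - (w l)%:P).
have Mw k : M.[w k] = v k.
  have prodE j : (\prod_(l | l != j) ('X - (w l)%:P)).[w k]
      = \prod_(l | l != j) (w k - w l).
    by rewrite horner_prod; apply: eq_bigr => l _; rewrite !hornerE.
  rewrite /M horner_sum (bigD1 k) //= hornerZ prodE divfK; last first.
    apply/prodf_neq0 => l lk; rewrite subr_eq0.
    by apply: contra lk => /eqP/w_inj->.
  rewrite big1 ?addr0 // => j jk; rewrite hornerZ prodE.
  by rewrite [X in _ * X](bigD1 k) 1?eq_sym //= subrr mul0r mulr0.
exists (M %% Q); split=> [|k].
  have sQ := (size_coef_prod_XsubC w).1; rewrite -ltnS; apply: leq_trans sQ.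
  by rewrite ltn_modp.
by have := Mw k; rewrite {1}(divp_eq M Q) !hornerE Qw mulr0 add0r.
Qed.

End Interpolation.

Section Bethe.
Variables (R : realType) (q : R[i]).
Hypothesis q_neq0 : q != 0.
Implicit Types (p : {poly R[i]}) (t z : R[i]).

Lemma horner_qshift p z : (qshift q p).[z] = p.[q * z].
Proof. by rewrite /qshift horner_comp !hornerE. Qed.

Lemma coef_qshift p i : (qshift q p)`_i = q ^+ i * p`_i.
Proof.
rewrite /qshift; elim/poly_ind: p i => [|p c IH] i.
  by rewrite comp_poly0 !coef0 mulr0.
rewrite comp_poly_MXaddC -scalerAr !coefD coefZ !coefMX !coefC.
by case: i => [|i] /=; rewrite ?mulr0 ?add0r ?expr0 ?mul1r // !addr0 IH exprS mulrA.
Qed.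

Lemma size_qshift p : size (qshift q p) = size p.
Proof. by rewrite size_comp_poly2 // size_scale // size_polyX. Qed.

Lemma qshiftM p p' : qshift q (p * p') = qshift q p * qshift q p'.
Proof. exact: comp_polyM. Qed.

Lemma qshiftD p p' : qshift q (p + p') = qshift q p + qshift q p'.
Proof. exact: comp_polyD. Qed.

(** The operator is diagonal on monomials, with eigenvalues 1 - t q^j. *)
Lemma q_difference_solvable t n p : (size p <= n.+1)%N ->
  (forall j, (j <= n)%N -> 1 - t * q ^+ j != 0) ->
  exists2 g : {poly R[i]}, (size g <= n.+1)%N & g - t *: qshift q g = p.
Proof.
move=> sp nz; exists (\poly_(j < n.+1) (p`_j / (1 - t * q ^+ j))).
  exact: size_poly.
apply/polyP => j; rewrite coefB coefZ coef_qshift coef_poly.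
case: ltnP => jn; last by rewrite !mulr0 subr0 nth_default // (leq_trans sp).
have := nz j jn; set d := 1 - _ => d0; rewrite mulrA -[X in X - _]mul1r -mulrBl.
by rewrite -/d mulrC divfK.
Qed.

(** M1 is chosen so that the QQ-equation holds at the w_k; the Bethe equations then
say that it holds at the w_k / q too. So the error F is a multiple
H Q(z) Q(q z), and adding Q g to M1 changes the left-hand side by
Q(z) Q(q z) (g(z) - t g(q z)). *)
Lemma QQ_partner_of_Bethe t m n (w : 'I_m -> R[i]) (L : {poly R[i]}) :
  let Q := \prod_k ('X - (w k)%:P) in
  injective w -> (size L <= (m + n).+1)%N ->
  (forall j, (j <= n)%N -> 1 - t * q ^+ j != 0) ->
  (forall k, Q.[q^-1 * w k] != 0) ->
  (forall k, Q.[q * w k] * L.[q^-1 * w k] = - t * L.[w k] * Q.[q^-1 * w k]) ->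
  exists2 M : {poly R[i]}, (size M <= (m + n).+1)%N & finite_QQ q t L Q M.
Proof.
move=> Q w_inj sL nz Qw0 bethe.
have Qmon : Q \is monic by apply/monic_prod => k _; apply: monicXsubC.
have sQ : size Q = m.+1.
  by rewrite /Q size_prod_XsubC -[index_enum _]enumT size_enum_ord.
have Qw k : Q.[w k] = 0 by rewrite horner_prod_XsubC prod_sub_self.
have Qqw0 k : Q.[q * w k] != 0.
  rewrite /Q horner_prod_XsubC; apply/prodf_neq0 => l _.
  rewrite subr_eq0; apply: contra (Qw0 l) => /eqP <-.
  by rewrite mulKf // Qw.
have [M1 [sM1 M1w]] := interpolation (fun k => L.[w k] / Q.[q * w k]) w_inj.
rewrite card_ord in sM1.
pose F := L - (qshift q Q * M1 - t *: (Q * qshift q M1)).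
have FE z : F.[z] = L.[z] - (Q.[q * z] * M1.[z] - t * (Q.[z] * M1.[q * z])).
  rewrite /F !(hornerD, hornerN, hornerM, hornerZ).
  by rewrite !horner_qshift.
pose rs := [seq w k | k <- enum 'I_m] ++ [seq w k / q | k <- enum 'I_m].
have rs_uniq : uniq rs.
  have u1 : uniq [seq w k | k <- enum 'I_m] by rewrite map_inj_uniq ?enum_uniq.
  have u2 : uniq [seq w k / q | k <- enum 'I_m].
    by rewrite map_inj_uniq ?enum_uniq // => k l /(divIf q_neq0)/w_inj.
  rewrite cat_uniq u1 u2 andbT /=; apply/hasPn => _ /mapP[k _ ->].
  apply/negP => /mapP[l _ E].
  by have := Qw0 k; rewrite mulrC E Qw eqxx.
have F_roots : all (root F) rs.
  rewrite all_cat; apply/andP; split; apply/allP => _ /mapP[k _ ->]; apply/rootP.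
    by rewrite FE Qw M1w mul0r mulr0 subr0 [Q.[_] * _]mulrC divfK ?subrr.
  have qwk : q * (w k / q) = w k by rewrite mulrC divfK.
  rewrite FE qwk Qw M1w mul0r sub0r opprK.
  apply: (mulfI (Qqw0 k)); rewrite mulr0 mulrDr.
  have := bethe k; rewrite (mulrC q^-1) => ->.
  have := Qqw0 k; set a := Q.[q * w k] => a0.
  by field.
have rsE : \prod_(z <- rs) ('X - z%:P) = Q * \prod_k ('X - (w k / q)%:P).
  have seqE (v : 'I_m -> R[i]) :
      \prod_(z <- [seq v k | k <- enum 'I_m]) ('X - z%:P) = \prod_k ('X - (v k)%:P).
    by rewrite big_map big_enum.
  by rewrite /rs big_cat /= (seqE w) (seqE (fun k => w k / q)).
have : exists H, F = H * (Q * qshift q Q).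
  have [||H HF] := @uniq_roots_prod_XsubC _ F rs => //.
    by rewrite uniq_rootsE.
  exists ((q ^+ m)^-1 *: H); rewrite (qshift_prod_XsubC q_neq0) card_ord.
  by rewrite -scalerAr -scalerAr -scalerAl scalerA divff ?expf_neq0 // scale1r -rsE.
move=> [H FH].
have Q0 : Q != 0 by rewrite -size_poly_eq0 sQ.
have qQ0 : qshift q Q != 0 by rewrite -size_poly_eq0 size_qshift sQ.
have sM p p' : (size p <= m.+1)%N -> (size p' <= m)%N ->
    (size (p * p')%R <= (m + n + m).+1)%N.
  move=> sp sp'; apply: leq_trans (size_polyMleq _ _) _.
  by have := leq_add sp sp'; lia.
have sF : (size F <= (m + n + m).+1)%N.
  rewrite (leq_trans (size_polyD _ _)) // geq_max size_polyN.
  rewrite (leq_trans sL) ?ltnS ?leq_addr //=.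
  rewrite (leq_trans (size_polyD _ _)) // geq_max size_polyN.
  rewrite sM ?size_qshift ?sQ //=.
  by rewrite (leq_trans (size_scale_leq _ _)) // sM ?size_qshift ?sQ.
have sH : (size H <= n.+1)%N.
  have [->|H0] := eqVneq H 0; first by rewrite size_poly0.
  move: sF; rewrite FH size_mul ?mulf_neq0 // size_mul // size_qshift sQ.
  by move: (size H) => h; lia.
have [g sg Hg] := q_difference_solvable sH nz.
exists (M1 + Q * g).
  have sQg : (size (Q * g)%R <= (m + n).+1)%N.
    apply: leq_trans (size_polyMleq _ _) _; rewrite sQ.
    by move: sg; move: (size g) => h; lia.
  apply: leq_trans (size_polyD _ _) _; rewrite geq_max sQg andbT.
  by apply: leq_trans sM1 _; lia.
rewrite /finite_QQ qshiftD qshiftM.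
have E := FH; rewrite -Hg /F in E.
have -> : L = qshift q Q * M1 - t *: (Q * qshift q M1)
    + (L - (qshift q Q * M1 - t *: (Q * qshift q M1))) by rewrite addrC subrK.
rewrite E -!mul_polyC; ring.
Qed.

End Bethe.

Section Degrees.
Variables (R : realType) (q : R[i]).
Hypothesis q_neq0 : q != 0.

(** The two genericity conditions on t: solvability of the q-difference equation,
and absence of cancellation of leading terms. *)
Lemma nondegenerate_near0 m n : exists2 delta : R, 0 < delta &
  forall t : R[i], normc t < delta ->
    (forall j, (j <= n)%N -> 1 - t * q ^+ j != 0) /\
    (forall d, (d <= m + n)%N -> q ^+ m - t * q ^+ d != 0).
Proof.
have gen (a b : R[i]) : a != 0 -> exists2 d : R, 0 < d &
    forall t, normc t < d -> a - t * b != 0.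
  move=> a0; have b1 : 0 < normc b + 1 by rewrite ltr_wpDl ?normc_ge0.
  exists (normc a / (normc b + 1)); first by rewrite divr_gt0 ?normc_gt0.
  move=> t; rewrite ltr_pdivlMr // => tb; rewrite subr_eq0; apply/eqP => E.
  by move: tb; rewrite E normcM; have := normc_ge0 t; lra.
have [||d d0 Hd] := @uniform_pos R 'I_(m + n).+1 (fun j d => forall t, normc t < d ->
    1 - t * q ^+ j != 0 /\ q ^+ m - t * q ^+ j != 0).
- move=> j; have [d1 d10 H1] := gen 1 (q ^+ j) (oner_neq0 _).
  have [d2 d20 H2] := gen (q ^+ m) (q ^+ j) (expf_neq0 _ q_neq0).
  exists (Num.min d1 d2); first by rewrite lt_min d10.
  by move=> t; rewrite lt_min => /andP[/H1 ? /H2].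
- by move=> j d e _ ed H t te; apply: H; lra.
exists d => // t td; split=> j jn.
  by have := Hd (inord j) t td; rewrite inordK; [case | lia].
by have := Hd (inord j) t td; rewrite inordK //; case.
Qed.

(** The leading coefficient of the left-hand side is that of M times
q^m - t q^(deg M), hence no cancellation of degrees occurs. *)
Lemma finite_QQ_degree t m n (L P M : {poly R[i]}) :
  size L = (m + n).+1 -> P \is monic -> size P = m.+1 ->
  (size M <= (m + n).+1)%N ->
  (forall d, (d <= m + n)%N -> q ^+ m - t * q ^+ d != 0) ->
  finite_QQ q t L P M -> size M = n.+1.
Proof.
move=> sL Pmon sP sM nz QQ.
have P0 : P != 0 by rewrite -size_poly_eq0 sP.
have M0 : M != 0.
  apply/negP => /eqP M0; move: QQ sL; rewrite /finite_QQ M0 /qshift comp_poly0.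
  by rewrite !mulr0 scaler0 subr0 => <-; rewrite size_poly0.
have sM1 := polySpred M0; set d := (size M).-1 in sM1.
have Mtop : M`_d != 0 by rewrite /d -lead_coefE lead_coef_eq0.
have P1 : P`_m = 1 by rewrite -(monicP Pmon) lead_coefE sP.
have c1 : (qshift q P * M)`_(m + d) = q ^+ m * M`_d.
  have := lead_coefM (qshift q P) M; rewrite !lead_coefE size_qshift // sP.
  rewrite size_mul -?size_poly_eq0 ?size_qshift // ?sP ?sM1 //.
  by rewrite coef_qshift P1 mulr1 addSn addnS.
have c2 : (P * qshift q M)`_(m + d) = q ^+ d * M`_d.
  have := lead_coefM P (qshift q M); rewrite !lead_coefE size_qshift // sP.
  rewrite size_mul -?size_poly_eq0 ?size_qshift // ?sP ?sM1 //.
  by rewrite coef_qshift P1 mul1r addSn addnS.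
have Ltop : L`_(m + d) != 0.
  rewrite -QQ coefB coefZ c1 c2 mulrA -mulrBl mulf_neq0 // nz //.
  by move: sM; rewrite sM1; lia.
have le1 : (d <= n)%N.
  rewrite leqNgt; apply/negP => nd; move/negP: Ltop; apply; apply/eqP.
  by rewrite nth_default // sL ltn_add2l.
have le2 : (m + n < (m + d).+1)%N.
  rewrite -sL -QQ (leq_trans (size_polyD _ _)) // geq_max size_polyN.
  rewrite (leq_trans (size_polyMleq _ _)) ?size_qshift // ?sP ?sM1 ?addSn ?addnS //=.
  rewrite (leq_trans (size_scale_leq _ _)) // (leq_trans (size_polyMleq _ _)) //.
  by rewrite size_qshift // sP sM1 addSn addnS.
by rewrite sM1; congr _.+1; lia.
Qed.

(** The scalar in [Qminus] is forced by comparing leading coefficients. *)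
Lemma finite_solution_split t m n (L P M : {poly R[i]}) :
  L \is monic -> size L = (m + n).+1 -> finite_solution q t L m n P M ->
  exists (x : 'I_m -> R[i]) (y : 'I_n -> R[i]),
    P = Qplus x /\ M = Qminus q t m y.
Proof.
move=> Lmon sL [Pmon sP sM QQ].
have [|v] := @poly_split R 'I_m P; first by rewrite card_ord.
rewrite (monicP Pmon) scale1r => Pv.
have [|v'] := @poly_split R 'I_n M; first by rewrite card_ord.
set mu := lead_coef M => Mv.
have EP : P = Qplus (fun i => - v i).
  by rewrite QplusE Pv; apply: eq_bigr => i _; rewrite opprK.
have EM : M = mu *: \prod_(j < n) ('X + (- v' j)%:P).
  by rewrite Mv; congr (_ *: _); apply: eq_bigr => i _; rewrite polyCN.
exists (fun i => - v i), (fun j => - v' j); split=> //.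
have cI : #|{: 'I_m + 'I_n}| = (m + n)%N by rewrite card_sum !card_ord.
move: QQ; rewrite EP EM => /(finite_QQ_scaled q_neq0) E.
have := congr1 (fun p : {poly R[i]} => p`_(m + n)) E.
have -> : L`_(m + n) = 1 by rewrite -(monicP Lmon) lead_coefE sL.
rewrite coefZ coefB !coefZ -cI.
rewrite (size_coef_prod_XsubC _).2 (size_coef_prod_linear _ _).2.
rewrite prod_numer_scale mulr1 => mu1.
rewrite /Qminus; congr (_ *: _).
have ct0 : q ^+ m - t * q ^+ n != 0.
  by apply: contra_eq_neq mu1 => ->; rewrite mulr0 eq_sym oner_neq0.
by apply: (mulIf ct0); rewrite mu1 mulVf.
Qed.

End Degrees.

Theorem theorem4p7 (R : realType) (q : R[i]) (m n : nat) (L : {poly R[i]})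
    (q_neq0 : q != 0) (L_monic : L \is monic) (L_size : size L = (m + n).+1)
    (L0_neq0 : L.[0] != 0) (L_simple : separable_poly L) :
  (forall (x0 : 'I_m -> R[i]) (y0 : 'I_n -> R[i]),
     infinite_solution q L x0 y0 ->
     exists (eps : R) (x : 'I_m -> R[i] -> R[i]) (y : 'I_n -> R[i] -> R[i]),
       analytic_solution q L x0 y0 eps x y)
  /\
  (* the family (eps, x, y) picks an analytic solution for every choice
     (x0, y0) of a solution of the infinite system *)
  (forall (eps : ('I_m -> R[i]) -> ('I_n -> R[i]) -> R)
          (x : ('I_m -> R[i]) -> ('I_n -> R[i]) -> 'I_m -> R[i] -> R[i])
          (y : ('I_m -> R[i]) -> ('I_n -> R[i]) -> 'I_n -> R[i] -> R[i]),
     (forall x0 y0, infinite_solution q L x0 y0 ->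
        analytic_solution q L x0 y0 (eps x0 y0) (x x0 y0) (y x0 y0)) ->
     exists2 delta : R, 0 < delta &
       [/\ forall (t : R[i]) (P M : {poly R[i]}), disc delta t ->
             finite_solution q t L m n P M ->
             exists x0 y0,
               [/\ infinite_solution q L x0 y0, disc (eps x0 y0) t,
                   P = Qplus (fun i => x x0 y0 i t) &
                   M = Qminus q t m (fun j => y x0 y0 j t)],
           forall (zeta : R[i]) (w : 'I_m -> R[i]),
             zeta != 0 -> disc delta (zeta ^- 2) ->
             Bethe_solution q zeta L w ->
             exists x0 y0,
               [/\ infinite_solution q L x0 y0, disc (eps x0 y0) (zeta ^- 2) &
                   forall k, w k = - x x0 y0 k (zeta ^- 2)] &
           forall (zeta : R[i]) x0 y0,
             zeta != 0 -> disc delta (zeta ^- 2) ->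
             infinite_solution q L x0 y0 ->
             (forall k v, root L v ->
                q_distinct q (- x x0 y0 k (zeta ^- 2)) v) ->
             Bethe_solution q zeta L (fun k => - x x0 y0 k (zeta ^- 2))]).
Proof.
split=> [x0 y0|eps x y branches]; first exact: QQ_branches.
have [d1 d10 H1] := branches_exhaust q_neq0 L_monic L_size L_simple branches.
have [d2 d20 H2] := nondegenerate_near0 q_neq0 m n.
exists (Num.min d1 d2); first by rewrite lt_min d10.
split.
- move=> t P M /discE; rewrite lt_min => /andP[td _] sol.
  have [x1 [y1 [EP EM]]] := finite_solution_split q_neq0 L_monic L_size sol.
  have [_ _ _] := sol; rewrite EP EM => /(H1 t td).1 [x0 [y0 [sol0 te -> ->]]].
  by exists x0, y0; split=> //; apply/discE.
- move=> zeta w zeta0 /discE; set t := zeta ^- 2; rewrite lt_min => /andP[td1 td2].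
  move=> [w_inj bethe]; set Q := \prod_(j < m) _ in bethe.
  have [nz1 nz2] := H2 t td2.
  have Qmon : Q \is monic by apply/monic_prod => k _; apply: monicXsubC.
  have sQ : size Q = m.+1.
    by rewrite /Q size_prod_XsubC -[index_enum _]enumT size_enum_ord.
  have [|||M sM QQ] := QQ_partner_of_Bethe q_neq0 (n := n) w_inj _ nz1 _ _ (L := L).
  + by rewrite L_size.
  + by move=> k; have [] := bethe k.
  + move=> k; have [Qk Lk E] := bethe k; rewrite -/Q.
    move: Qk Lk E; set a := Q.[q^-1 * _]; set b := L.[q^-1 * _] => a0 b0 E.
    have -> : Q.[q * w k] = t * (zeta ^+ 2 * (Q.[q * w k] / a)) * a.
      by rewrite mulrA mulVf ?expf_neq0 // mul1r divfK.
    by rewrite E; field.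
  have QE : Q = Qplus (fun k => - w k).
    by rewrite QplusE; apply: eq_bigr => k _; rewrite opprK.
  have sol : finite_solution q t L m n Q M.
    by split=> //; exact: finite_QQ_degree L_size Qmon sQ sM nz2 QQ.
  have [x1 [y1 [EP EM]]] := finite_solution_split q_neq0 L_monic L_size sol.
  move: QQ; rewrite -/Q QE EM => /(H1 t td1).1 [x0 [y0 [sol0 te Ex _]]].
  exists x0, y0; split=> //; first exact/discE.
  by move=> k; have := congr1 (fun f => - f k) Ex; rewrite /= opprK.
move=> zeta x0 y0 zeta0 /discE; set t := zeta ^- 2; rewrite lt_min => /andP[td _].
move=> sol0 qd; have [te x_inj] := (H1 t td).2 _ _ sol0.
rewrite /Bethe_solution; set Q := \prod_(j < m) _.
split=> [k l /oppr_inj/x_inj //|k].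
have [_ _ _ /(_ t ((discE _ _).2 te))] := branches _ _ sol0.
have <- : Q = Qplus (fun i => x x0 y0 i t).
  by rewrite QplusE.
move: (Qminus _ _ _ _) => M QQ.
set w := - x x0 y0 k t.
have Qw : Q.[w] = 0 by rewrite horner_prod_XsubC prod_sub_self.
have LE z : L.[z] = Q.[q * z] * M.[z] - t * (Q.[z] * M.[q * z]).
  by rewrite -[L]QQ !(hornerD, hornerN, hornerM, hornerZ) !horner_qshift.
have L1 : L.[q^-1 * w] != 0.
  apply/negP => /qd - /(_ k) [_ _ /(_ (-1) 0)].
  by rewrite exprN1 expr0z mul1r eqxx.
(* As L does not vanish at w / q, neither do the factors of its value there. *)
have E1 : L.[q^-1 * w] = - (t * (Q.[q^-1 * w] * M.[w])).
  by rewrite LE mulVKf // Qw mul0r sub0r.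
have E2 : L.[w] = Q.[q * w] * M.[w] by rewrite LE Qw mul0r mulr0 subr0.
have /and3P[t0 Q1 M1] : [&& t != 0, Q.[q^-1 * w] != 0 & M.[w] != 0].
  by move: L1; rewrite E1 oppr_eq0 !mulf_eq0 !negb_or.
split=> //.
by rewrite E2 E1 /t; field; rewrite Q1 M1 zeta0.
Qed.
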